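(* There is a universal constant $C>0$ such that the following holds. Let $\alpha\ge2$, $0<\sigma\le L$, and let $X_1,\dots,X_n$ be i.i.d. random vectors in $\mathbb R^d$ with mean $\mu=\mathbb EX_i$ and covariance matrix $\Sigma=\mathbb E(X_i-\mu)(X_i-\mu)^\top$, such that for every unit vector $u\in\mathbb S^{d-1}$ and all integers $k\ge2$, $$\mathbb E\left|(X_i-\mu)^\top u\right|^k\le k^{\frac k\alpha}\sigma^2L^{k-2}.$$ Let $\widehat\mu:=\frac1n\sum_{i=1}^nX_i$ and $\widehat\Sigma:=\frac1n\sum_{i=1}^n(X_i-\widehat\mu)(X_i-\widehat\mu)^\top$. Then for all $t>0$: if $\alpha\ge4$, $$\mathbb P\left(\|\widehat\Sigma-\Sigma\|\ge C\min\left\{L^2\left(\frac{t+d}n\right)^{\frac2\alpha},\ \sigma L\left(\frac{t+d}n\right)^{\frac12}+L^2\frac{t+d}n\right\}\right)\le2\exp(-t),$$ and if $2\le\alpha\le4$, $$\mathbb P\left(\|\widehat\Sigma-\Sigma\|\ge C\sigma L\left(\frac{t+d}n\right)^{\frac12}+C\min\left\{L^2\left(\frac{t+d}n\right)^{\frac2\alpha},\ L^2\frac{t+d}n\right\}\right)\le2\exp(-t).$$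
   Context: $\|\cdot\|$ on matrices is the operator norm; $\mathbb S^{d-1}$ is the unit Euclidean sphere in $\mathbb R^d$. *)

(* Defs.v *)
From mathcomp Require Import all_boot all_order all_algebra.
From mathcomp Require Import all_classical all_reals all_analysis.

Set Implicit Arguments.
Unset Strict Implicit.
Unset Printing Implicit Defensive.

Import Order.TTheory GRing.Theory Num.Theory.

Local Open Scope classical_set_scope.
Local Open Scope ring_scope.

Definition enorm (R : realType) (d : nat) (u : 'cV[R]_d) : R :=
  Num.sqrt (\sum_(j < d) u j 0 ^+ 2).

Definition unit_sphere (R : realType) (d : nat) : set 'cV[R]_d :=
  [set u | enorm u = 1].
Arguments unit_sphere : clear implicits.

(* The supremum is a genuine one as soon as 0 < d: the set is then nonempty
   (and it is always bounded). *)
Definition opnorm (R : realType) (m d : nat) (A : 'M[R]_(m, d)) : R :=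
  sup [set enorm (A *m u) | u in unit_sphere R d].

(* Random vectors take values in d.-tuple R, whose library sigma-algebra (the
   one generated by the coordinates) is the Borel sigma-algebra of R^d;
   tcol moves to column vectors for the linear algebra. *)
Definition tcol (R : realType) (d : nat) (x : d.-tuple R) : 'cV[R]_d :=
  \col_j tnth x j.

Section RandomVectors.
Context {disp : measure_display} {T : measurableType disp} {R : realType}.
Variable P : probability T R.

Definition has_expectation (m p : nat) (Y : T -> 'M[R]_(m, p))
    (M : 'M[R]_(m, p)) : Prop :=
  forall i j,
    P.-integrable setT (fun w => (Y w i j)%:E) /\
    'E_P[fun w => Y w i j]%E = (M i j)%:E.

Definition has_covariance (d : nat) (Y : T -> 'cV[R]_d)
    (mu : 'cV[R]_d) (Sigma : 'M[R]_d) : Prop :=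
  has_expectation (fun w => (Y w - mu) *m (Y w - mu)^T) Sigma.

Context {disp' : measure_display} {T' : measurableType disp'}.

Definition mutually_independent (n : nat) (X : 'I_n -> {RV P >-> T'}) : Prop :=
  forall (J : {set 'I_n}) (B : 'I_n -> set T'),
    (forall i, measurable (B i)) ->
    P (\bigcap_(i in [set` J]) (X i @^-1` B i)) =
    (\prod_(i in J) P (X i @^-1` B i))%E.

Definition identically_distributed (n : nat) (X : 'I_n -> {RV P >-> T'}) :
    Prop :=
  forall (i j : 'I_n) (B : set T'), measurable B ->
    distribution P (X i) B = distribution P (X j) B.

Definition iid (n : nat) (X : 'I_n -> {RV P >-> T'}) : Prop :=
  mutually_independent X /\ identically_distributed X.

End RandomVectors.

Definition sample_mean (R : realType) (d n : nat) (x : 'I_n -> 'cV[R]_d) :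
    'cV[R]_d :=
  n%:R^-1 *: \sum_(i < n) x i.

Definition sample_cov (R : realType) (d n : nat) (x : 'I_n -> 'cV[R]_d) :
    'M[R]_d :=
  n%:R^-1 *: \sum_(i < n) (x i - sample_mean x) *m (x i - sample_mean x)^T.

(* Main.v *)
Require Import Defs.
From mathcomp Require Import all_boot all_order all_algebra.
From mathcomp Require Import all_classical all_reals all_analysis.
From mathcomp Require Import finmap measurable_realfun ring lra zify.
Import Order.TTheory GRing.Theory Num.Theory.
Import numFieldNormedType.Exports.
Local Open Scope classical_set_scope.
Local Open Scope ring_scope.

(** Write [delta := (t + d) / n], [Z := dot (X i - mu) v] for a fixed vector [v]
    of the unit ball, and consider the quadratic form of the error,
    [q v := dot v ((sample_cov X - Sigma) v)], which equals (mean of the [Z ^ 2])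
    minus (square of the mean of the [Z]) minus [E Z ^ 2]
    ([sample_cov_quad_form]).

    Both thresholds of the theorem dominate, up to constants, the same quantity:
    [sigma L sqrt delta + L ^ 2 delta] if [delta <= 1], and
    [L ^ 2 delta ^ (2 / alpha)] if [delta >= 1]. This only involves comparing the
    powers of [delta] with exponents 1/2, 2/alpha and 1, and it leaves a single
    bound to prove on each side of [delta = 1], for all [alpha >= 2].

    For [delta <= 1] the moments of [Z ^ 2] satisfy Bernstein's condition
    [E |Y| ^ k <= k! a b ^ k] with [a] of order [(sigma / L) ^ 2] and [b] of order
    [L ^ 2], and those of [Z] satisfy it with [a = 1] and [b] of order [L]. A
    two-sided Bernstein inequality ([bernstein2]) at level [t + d] gives both
    terms of the threshold ([tail_small_delta]). For [delta >= 1] the variable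
    [|Z| ^ alpha] satisfies the same condition with [a = 2] and [b] of order
    [(alpha + 1) L ^ alpha], so the mean of the [|Z| ^ alpha] is at most of order
    [b delta]. A power mean comparison then bounds the mean of the [Z ^ 2] by
    [L ^ 2 delta ^ (2 / alpha)]; the constant stays universal because
    [(alpha + 1) ^ (1 / alpha)] is bounded ([tail_large_delta]).

    The passage from one vector to the operator norm is a net argument. The net
    consists of the points of a lattice of mesh [1 / (4 sqrt d)] in the unit
    ball; it has at most [64 ^ d] points, by a generating function count
    ([card_net]), so an exponent proportional to [t + d] pays for the union
    bound ([opnorm_tail_from_net]).

    Two facts of measure theory are needed on the way. Independence, a property
    of events, is transported to expectations of products
    ([mutually_independent_integral]), and the operator norm of a random matrix
    is shown to be measurable ([measurable_opnorm_ge]). *)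

(** * Quadratic forms and the operator norm *)

Section Euclidean.
Context {R : realType} {d : nat}.
Implicit Types (u v w : 'cV[R]_d) (A : 'M[R]_d).

Definition dot u v : R := (u^T *m v) 0 0.

Lemma dotE u v : dot u v = \sum_(j < d) u j 0 * v j 0.
Proof. by rewrite /dot mxE; apply: eq_bigr => j _; rewrite mxE. Qed.

Lemma dotC u v : dot u v = dot v u.
Proof. by rewrite !dotE; apply: eq_bigr => j _; rewrite mulrC. Qed.

Lemma dotDl u v w : dot (u + v) w = dot u w + dot v w.
Proof. by rewrite /dot linearD /= mulmxDl mxE. Qed.

Lemma dotZl a u v : dot (a *: u) v = a * dot u v.
Proof. by rewrite /dot linearZ /= -scalemxAl mxE. Qed.

Lemma dotNl u v : dot (- u) v = - dot u v.
Proof. by rewrite -scaleN1r dotZl mulN1r. Qed.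

Lemma dotDr u v w : dot u (v + w) = dot u v + dot u w.
Proof. by rewrite ![dot u _]dotC dotDl. Qed.

Lemma dotZr a u v : dot u (a *: v) = a * dot u v.
Proof. by rewrite ![dot u _]dotC dotZl. Qed.

Lemma dotNr u v : dot u (- v) = - dot u v.
Proof. by rewrite ![dot u _]dotC dotNl. Qed.

Lemma dot_suml I (r : seq I) (F : I -> 'cV[R]_d) v :
  dot (\sum_(i <- r) F i) v = \sum_(i <- r) dot (F i) v.
Proof.
by rewrite /dot linear_sum /= mulmx_suml summxE.
Qed.

Lemma dot_ge0 u : 0 <= dot u u.
Proof. by rewrite dotE sumr_ge0 // => j _; rewrite -expr2 sqr_ge0. Qed.

Lemma enorm_dot u : enorm u = Num.sqrt (dot u u).
Proof. by rewrite /enorm dotE; under eq_bigr do rewrite expr2. Qed.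

Lemma unit_sphere_dot u : unit_sphere R d u <-> dot u u = 1.
Proof.
rewrite /unit_sphere /= enorm_dot; split=> [h|->]; last by rewrite sqrtr1.
by rewrite -(sqr_sqrtr (dot_ge0 u)) h expr1n.
Qed.

Lemma dot_eq0 u : dot u u = 0 -> u = 0.
Proof.
rewrite dotE => /eqP; rewrite psumr_eq0 => [|j _]; last by rewrite -expr2 sqr_ge0.
move=> /allP h; apply/colP => j; rewrite mxE.
by have := h j (mem_index_enum _); rewrite mulf_eq0 orbb => /eqP.
Qed.

Lemma sym_dot_mulmx A u v : A^T = A -> dot (A *m u) v = dot u (A *m v).
Proof. by move=> sA; rewrite /dot trmx_mul sA mulmxA. Qed.

(** The parallelogram law turns the bounds on the form at [u + v] and [u - v]
    into a bound on the bilinear form. *)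
Lemma polarization_le A M u v : A^T = A ->
  (forall x, `|dot x (A *m x)| <= M * dot x x) ->
  dot (A *m u) v <= M / 2 * (dot u u + dot v v).
Proof.
move=> sA hM.
have /ler_normlP[_ h1] := hM (u + v).
have /ler_normlP[h2 _] := hM (u - v).
have E : dot v (A *m u) = dot u (A *m v) by rewrite dotC sym_dot_mulmx.
move: h1 h2; rewrite !(mulmxDr, mulmxN) !(dotDl, dotDr, dotNl, dotNr) E.
by rewrite (dotC v u) sym_dot_mulmx //; nra.
Qed.

(** Polarization at [u] and [v := A u / M] balances the two sides, so that the
    quadratic form controls [A u] with the same constant [M]. *)
Lemma dot_mulmx_le A M u : A^T = A -> 0 < M ->
  (forall x, `|dot x (A *m x)| <= M * dot x x) ->
  dot (A *m u) (A *m u) <= M ^+ 2 * dot u u.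
Proof.
move=> sA M0 hM; have := polarization_le A M u (M^-1 *: (A *m u)) sA hM.
rewrite dotZr dotZl dotZr; set a := dot (A *m u) _; set b := dot u u => h.
have -> : a = M * (M^-1 * a) by rewrite mulVKf // gt_eqF.
have E : M / 2 * (b + M^-1 * (M^-1 * a)) = M / 2 * b + (M^-1 * a) / 2.
  by field; rewrite gt_eqF.
rewrite E in h; rewrite expr2 -mulrA ler_pM2l //; lra.
Qed.

Lemma quad_form_bounded A x : dot x x <= 1 ->
  `|dot x (A *m x)| <= \sum_i \sum_j `|A i j|.
Proof.
move=> x1.
have xj j : `|x j 0| <= 1.
  rewrite -(ler_pXn2r (n := 2)) ?nnegrE // expr1n real_normK ?num_real //.
  apply: le_trans x1; rewrite dotE (bigD1 j) //= -expr2 lerDl sumr_ge0 //.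
  by move=> i _; rewrite -expr2 sqr_ge0.
rewrite dotE; apply: le_trans (ler_norm_sum _ _ _) _; apply: ler_sum => i _.
rewrite normrM mxE; apply: (@le_trans _ _ (1 * `|\sum_j A i j * x j 0|)).
  by rewrite ler_wpM2r.
rewrite mul1r; apply: le_trans (ler_norm_sum _ _ _) _; apply: ler_sum => j _.
by rewrite normrM -[leRHS]mulr1 ler_wpM2l.
Qed.

Lemma opnorm_has_sup (A : 'M[R]_d) : (0 < d)%N ->
  has_sup [set enorm (A *m u) | u in unit_sphere R d].
Proof.
move=> d0; split.
  pose e : 'cV[R]_d := \col_j (j == Ordinal d0)%:R.
  exists (enorm (A *m e)), e => //; apply/unit_sphere_dot.
  rewrite dotE (bigD1 (Ordinal d0)) //= !mxE eqxx mulr1 big1 ?addr0 // => j /negPf.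
  by rewrite !mxE => ->; rewrite mulr0.
exists (Num.sqrt (\sum_i \sum_j `|(A^T *m A) i j|)) => _ [u /unit_sphere_dot u1 <-].
rewrite enorm_dot ler_wsqrtr //.
(* The quadratic form of A^T A is bounded on the sphere by its entries. *)
have -> : dot (A *m u) (A *m u) = dot u ((A^T *m A) *m u).
  by rewrite /dot trmx_mul -!mulmxA.
by apply: le_trans (ler_norm _) _; rewrite quad_form_bounded // u1.
Qed.

Lemma opnorm_le A M : (0 < d)%N -> A^T = A -> 0 < M ->
  (forall x, `|dot x (A *m x)| <= M * dot x x) -> opnorm A <= M.
Proof.
move=> d0 sA M0 hM; apply: ge_sup; first by have [] := opnorm_has_sup A d0.
move=> _ [u /unit_sphere_dot u1 <-].
rewrite enorm_dot -(ler_pXn2r (n := 2)) ?nnegrE ?sqrtr_ge0 ?(ltW M0) //.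
by rewrite sqr_sqrtr ?dot_ge0 // -[leRHS]mulr1 -u1 dot_mulmx_le.
Qed.

(** The supremum [Q] of the form over the unit ball satisfies
    [Q <= B + Q / 2]: moving [x] to a point [v] of the net changes the form by
    [dot (A (x - v)) (x + v)], which polarization bounds by [Q / 2] when [x] and
    [v] are within distance 1/4. *)
Lemma quad_form_net A B (N : set 'cV[R]_d) : A^T = A ->
  (forall x, dot x x <= 1 -> exists2 v, N v &
     dot v v <= 1 /\ dot (x - v) (x - v) <= 1 / 16) ->
  (forall v, N v -> `|dot v (A *m v)| <= B) ->
  forall x, `|dot x (A *m x)| <= 2 * B * dot x x.
Proof.
move=> sA hN hB.
pose S := [set `|dot x (A *m x)| | x in [set x | dot x x <= 1]].
have dot0 : dot 0 0 = 0 by rewrite dotE big1 // => j _; rewrite mxE mul0r.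
have S0 : S !=set0.
  by exists `|dot 0 (A *m 0)|, 0 => //=; rewrite dot0.
have bS : has_ubound S.
  by exists (\sum_i \sum_j `|A i j|) => _ [x /= x1 <-]; exact: quad_form_bounded.
pose Q := sup S.
have hQ1 x : dot x x <= 1 -> `|dot x (A *m x)| <= Q.
  by move=> x1; apply: ub_le_sup => //; exists x.
have scale M : (forall x, dot x x <= 1 -> `|dot x (A *m x)| <= M) ->
    forall x, `|dot x (A *m x)| <= M * dot x x.
  move=> hM x; have := dot_ge0 x; rewrite le_eqVlt => /orP[/eqP/esym x0|x0].
    by rewrite (dot_eq0 _ x0) mulmx0 dot0 normr0 mulr0.
  pose r := Num.sqrt (dot x x).
  have r0 : 0 < r by rewrite sqrtr_gt0.
  have rr : r ^+ 2 = dot x x by rewrite sqr_sqrtr // ltW.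
  have /hM : dot (r^-1 *: x) (r^-1 *: x) <= 1.
    by rewrite dotZl dotZr mulrA -invfM -expr2 rr mulVf // gt_eqF.
  rewrite -scalemxAr dotZl dotZr mulrA -invfM -expr2 rr normrM.
  rewrite gtr0_norm ?invr_gt0 // mulrC ler_pdivrMr //.
have hQ := scale Q hQ1.
have Q0 : 0 <= Q by apply: le_trans (hQ1 0 _); rewrite ?dot0.
apply: scale => x x1; apply: le_trans (hQ1 x x1) _.
suff : Q <= B + Q / 2 by lra.
apply: ge_sup => // _ [y /= y1 <-].
have [v Nv [v1 yv]] := hN y y1.
have E : dot y (A *m y) - dot v (A *m v) = dot (A *m (y - v)) (y + v).
  have C : dot y (A *m v) = dot v (A *m y) by rewrite dotC sym_dot_mulmx.
  rewrite sym_dot_mulmx // !(mulmxDr, mulmxN) !(dotDl, dotDr, dotNl, dotNr) C.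
  by ring.
have yv4 : dot (y + v) (y + v) <= 4.
  have := dot_ge0 (y - v).
  by rewrite !(dotDl, dotDr, dotNl, dotNr); lra.
(* Scaling the short vector by 8 makes both squared norms at most 4. *)
have split8 s : `|s| = 1 -> s * dot (A *m (y - v)) (y + v) <= Q / 2.
  move=> s1; have := polarization_le A Q (8 *: (y - v)) (s *: (y + v)) sA hQ.
  rewrite -scalemxAr !(dotZl, dotZr) [s * (s * _)]mulrA -expr2.
  rewrite -real_normK ?num_real // s1 expr1n mul1r.
  set D := dot (A *m _) _; set a := dot (y - v) _; set b := dot (y + v) _.
  by move: yv yv4; rewrite -/a -/b; nra.
have {}E : dot y (A *m y) = dot v (A *m v) + dot (A *m (y - v)) (y + v).
  by rewrite -E addrC subrK.
rewrite E; apply: le_trans (ler_normD _ _) _; apply: lerD; first exact: hB.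
have := split8 1 (normr1 _); have := split8 (-1) (normrN1 _).
by rewrite mulN1r mul1r => h1 h2; apply/ler_normlP; split.
Qed.

End Euclidean.

(** * A finite net of the unit ball, and measurability of the operator norm *)

Section Net.
Context {R : realType}.

(** A lattice point is coded by the sign and the magnitude of each coordinate,
    in units of [1 / (4 sqrt d)]; 0 has two codes, which costs a factor at most 2
    per coordinate in the count below. *)
Definition lattice_code d := {ffun 'I_d -> bool * 'I_(4 * d).+1}.

Definition lattice_pt d (f : lattice_code d) : 'cV[R]_d :=
  \col_j ((-1) ^+ (f j).1 * (f j).2%:R / (4 * Num.sqrt d%:R)).

(** On the unit ball the l1 norm is at most [sqrt d], that is [4 d] units. This
    l1 constraint is what keeps the number of points exponential in [d]. *)
Definition net d : {set lattice_code d} :=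
  [set f : lattice_code d | (\sum_j (f j).2 <= 4 * d)%N].

(** Weighting a code by [2 ^ (- sum of magnitudes)] costs a factor [2 ^ (4 d)]
    on the net, and the weights sum to a product of [d] geometric series, each
    at most 4 once the two signs are counted. *)
Lemma card_net d : #|net d|%:R <= 64 ^+ d :> R.
Proof.
have half_ge0 : 0 <= 2^-1 :> R by rewrite invr_ge0.
rewrite -sum1_card natr_sum.
pose w (p : bool * 'I_(4 * d).+1) : R := 2^-1 ^+ p.2.
apply: (@le_trans _ _ (\sum_(f : lattice_code d) 2 ^+ (4 * d) * \prod_j w (f j))).
  rewrite [leRHS](bigID (mem (net d))) /= -[leLHS]addr0; apply: lerD; last first.
    by apply: sumr_ge0 => f _; rewrite mulr_ge0 ?exprn_ge0 // prodr_ge0 // => j _;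
       rewrite exprn_ge0.
  apply: ler_sum => f; rewrite inE => hf; rewrite /w prodrXr exprVn.
  by rewrite ler_pdivlMr ?exprn_gt0 // mul1r ler_weXn2l // ler1n.
rewrite -big_distrr /= -(bigA_distr_bigA (fun _ : 'I_d => w)) /= prodr_const card_ord.
have -> : 64 ^+ d = 2 ^+ (4 * d) * 4 ^+ d :> R.
  by rewrite exprM -exprMn; congr (_ ^+ d); lra.
rewrite ler_wpM2l ?exprn_ge0 // lerXn2r ?nnegrE //.
  by apply: sumr_ge0 => p _; rewrite exprn_ge0.
rewrite -(pair_big xpredT xpredT (fun (_ : bool) (k : 'I_(4 * d).+1) => 2^-1 ^+ k)) /=.
rewrite big_const card_bool /= addr0.
suff : \sum_(k < (4 * d).+1) 2^-1 ^+ k <= 2 :> R by lra.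
have := subrX1 (2^-1 : R) (4 * d).+1; have : 0 <= 2^-1 ^+ (4 * d).+1 :> R by rewrite exprn_ge0.
lra.
Qed.

(** Coordinates are rounded toward 0, which keeps the point in the ball; each
    coordinate moves by at most [1 / (4 sqrt d)]. *)
Lemma net_covers d (u : 'cV[R]_d) : (0 < d)%N -> dot u u <= 1 ->
  exists2 f, f \in net d &
    dot (lattice_pt d f) (lattice_pt d f) <= 1 /\
    dot (u - lattice_pt d f) (u - lattice_pt d f) <= 1 / 16.
Proof.
move=> d0 u1; set r : R := Num.sqrt d%:R.
have r0 : 0 < r by rewrite sqrtr_gt0 ltr0n.
have rr : r ^+ 2 = d%:R by rewrite sqr_sqrtr.
pose m j := Num.truncn (4 * r * `|u j 0|).
have mP j : (m j)%:R <= 4 * r * `|u j 0| < (m j).+1%:R.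
  by apply: truncn_itv; rewrite !mulr_ge0 // ltW.
have uj2 j : `|u j 0| ^+ 2 = u j 0 * u j 0 by rewrite real_normK ?num_real // expr2.
have sum_m : (\sum_j m j <= 4 * d)%N.
  rewrite -(ler_nat R) natr_sum.
  apply: (@le_trans _ _ (\sum_(j < d) (2 + 2 * d%:R * (u j 0 * u j 0)))).
    apply: ler_sum => j _; have /andP[h _] := mP j; apply: le_trans h _.
    (* 4 r x <= 2 + 2 (r x)^2 trades the l1 norm for the l2 norm. *)
    rewrite -uj2 -rr; set x := `|_|; have : 0 <= (1 - r * x) ^+ 2 by rewrite sqr_ge0.
    lra.
  rewrite big_split /= sumr_const card_ord -mulr_sumr -dotE -mulr_natr natrM.
  have : 0 <= d%:R :> R by [].
  by nra.
have mlt j : (m j < (4 * d).+1)%N.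
  rewrite ltnS; apply: leq_trans sum_m; rewrite (bigD1 j) //=; exact: leq_addr.
pose f : lattice_code d := [ffun j => (u j 0 < 0, Ordinal (mlt j))].
have fE j : lattice_pt d f j 0 = (-1) ^+ (u j 0 < 0)%R * ((m j)%:R / (4 * r)).
  by rewrite mxE ffunE /= mulrA.
have c0 : 0 < 4 * r by lra.
have mr j : (m j)%:R / (4 * r) <= `|u j 0| < (m j)%:R / (4 * r) + (4 * r)^-1.
  have /andP[h1 h2] := mP j.
  rewrite ler_pdivrMr // mulrC h1 /= -[X in _ + X]mul1r -mulrDl ltr_pdivlMr //.
  by rewrite mulrC natr1.
exists f; first by rewrite inE (eq_bigr m) // => j _; rewrite ffunE.
split.
  apply: le_trans u1; rewrite !dotE; apply: ler_sum => j _.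
  rewrite fE -uj2 -expr2 exprMn sqrr_sign mul1r.
  have /andP[h _] := mr j; rewrite lerXn2r ?nnegrE ?divr_ge0 //.
  exact: ltW.
rewrite dotE; apply: (@le_trans _ _ (\sum_(j < d) (16 * d%:R)^-1)); last first.
  rewrite sumr_const card_ord -[_ *+ _]mulr_natr invfM mulfVK ?mul1r //.
  by rewrite pnatr_eq0 -lt0n.
apply: ler_sum => j _; rewrite mxE mxE fE -expr2.
rewrite {1}[u j 0]realEsign ?num_real // -mulrBr exprMn sqrr_sign mul1r.
have -> : (16 * d%:R)^-1 = (4 * r)^-1 ^+ 2 by rewrite exprVn exprMn rr; congr (_ * _)^-1; lra.
have /andP[h1 h2] := mr j.
by rewrite lerXn2r ?nnegrE ?subr_ge0 ?invr_ge0 ?(ltW c0) //; lra.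
Qed.

End Net.

Section OpnormMeasurable.
Context {R : realType} {d : nat}.

(** The strict inequality is an open condition on [u], and rational vectors are
    dense. *)
Lemma rational_witness (A : 'M[R]_d) (k : R) (u : 'cV[R]_d) :
  k * dot u u < dot (A *m u) (A *m u) ->
  exists q : {ffun 'I_d -> rat}, let x := \col_j ratr (q j) in
    k * dot x x < dot (A *m x) (A *m x).
Proof.
move=> hu.
have /choice[q hq] : forall n : nat, exists q : {ffun 'I_d -> rat},
    forall j, u j 0 <= ratr (q j) <= u j 0 + harmonic n.
  move=> n; have /choice[g hg] : forall j, exists q : rat,
      u j 0 <= ratr q <= u j 0 + harmonic n.
    move=> j; have [|q] := @rat_in_itvoo R (u j 0) (u j 0 + harmonic n).
      by rewrite ltrDl harmonic_gt0.
    by rewrite in_itv /= => /andP[h1 h2]; exists q; rewrite !ltW.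
  by exists [ffun j => g j] => j; rewrite ffunE.
have cq j : (ratr (q n j) : R) @[n --> \oo] --> u j 0.
  apply: (@squeeze_cvgr _ _ _ _ (cst (u j 0)) (fun n => u j 0 + harmonic n)).
  - by apply: nearW => n; apply: hq.
  - exact: cvg_cst.
  - rewrite -[X in _ --> X]addr0; apply: cvgD; first exact: cvg_cst.
    exact: cvg_harmonic.
pose phi (x : 'I_d -> R) := \sum_i ((\sum_j A i j * x j) * (\sum_j A i j * x j))
  - k * \sum_j x j * x j.
have phiE (x : 'cV[R]_d) :
    phi (fun j => x j 0) = dot (A *m x) (A *m x) - k * dot x x.
  by rewrite /phi !dotE; congr (_ - _); apply: eq_bigr => i _; rewrite !mxE.
have : phi (fun j => ratr (q n j)) @[n --> \oo] --> phi (fun j => u j 0).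
  apply: cvgB.
    apply: cvg_big => [|i _]; first exact: add_continuous.
    by apply: cvgM; (apply: cvg_big => [|j _]; [exact: add_continuous|
      apply: cvgM; [exact: cvg_cst|exact: cq]]).
  apply: cvgM; first exact: cvg_cst.
  by apply: cvg_big => [|j _]; [exact: add_continuous|apply: cvgM; exact: cq].
move=> /cvgr_gt /(_ 0); rewrite phiE subr_gt0 => /(_ hu)[n _ /(_ n (leqnn n)) /=].
move=> h; exists (q n) => /=; rewrite -subr_gt0 -phiE.
by congr (0 < phi _) : h; apply/funext => j; rewrite mxE.
Qed.

Lemma measurable_lt_set {disp} {T : measurableType disp} (f g : T -> R) :
  measurable_fun setT f -> measurable_fun setT g -> measurable [set w | f w < g w].
Proof.
move=> mf mg.
have := measurable_fun_ltr mf mg measurableT (Y := [set true]) I.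
by rewrite setTI.
Qed.

(** Only countably many vectors occur on the right, which is what makes the
    operator norm of a random matrix measurable. The form is homogeneous, so
    that the vectors need not be normalized, and the slack [c / (m + 1)] turns
    the condition on the supremum into strict inequalities. *)
Lemma opnorm_geP (A : 'M[R]_d) (c : R) : (0 < d)%N -> 0 < c ->
  c <= opnorm A <-> forall m : nat, exists q : {ffun 'I_d -> rat},
    let x := \col_j ratr (q j) in
    (c - c * m.+1%:R^-1) ^+ 2 * dot x x < dot (A *m x) (A *m x).
Proof.
move=> d0 c0; have hS := opnorm_has_sup A d0.
have cm0 m : 0 <= c - c * m.+1%:R^-1.
  by rewrite subr_ge0 ler_piMr ?(ltW c0) // invf_le1 // ler1n.
split=> [cA m|h].
  have : c - c * m.+1%:R^-1 < opnorm A.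
    by apply: lt_le_trans cA; rewrite ltrBlDr ltrDl mulr_gt0 // invr_gt0.
  move=> /sup_gt[]; first by case: hS.
  move=> _ [u /unit_sphere_dot u1 <-] cu; apply: (rational_witness _ _ u).
  by rewrite u1 mulr1 -[ltRHS]sqr_sqrtr ?dot_ge0 // -enorm_dot ltrXn2r ?nnegrE //
    ltW // (le_lt_trans _ cu).
rewrite leNgt; apply/negP => Ac.
have [m hm] : exists m : nat, opnorm A + c * m.+1%:R^-1 < c.
  have [|m hm] := @ltr_add_invr R (opnorm A / c) 1; first by rewrite ltr_pdivrMr ?mul1r.
  by exists m; move: hm; rewrite -(ltr_pM2l c0) mulr1 mulrDr mulrCA mulfV ?mulr1 ?gt_eqF.
have [q /= hq] := h m; set x := \col_j _ in hq.
have x0 : 0 < dot x x.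
  rewrite lt_neqAle dot_ge0 andbT; apply/eqP => /esym /dot_eq0 x0.
  by move: hq; rewrite x0 mulmx0 /dot mulmx0 mxE mulr0 ltxx.
pose r := Num.sqrt (dot x x).
have r0 : 0 < r by rewrite sqrtr_gt0.
have rr : r ^+ 2 = dot x x by rewrite sqr_sqrtr // ltW.
have : enorm (A *m (r^-1 *: x)) <= opnorm A.
  apply: ub_le_sup; first by case: hS.
  exists (r^-1 *: x) => //; apply/unit_sphere_dot.
  by rewrite dotZl dotZr mulrA -invfM -expr2 rr mulVf // gt_eqF.
have : c - c * m.+1%:R^-1 < enorm (A *m (r^-1 *: x)).
  rewrite enorm_dot -[ltLHS]ger0_norm // -sqrtr_sqr ltr_sqrt; last first.
    rewrite -scalemxAr dotZl dotZr mulrA -invfM -expr2 rr mulr_gt0 ?invr_gt0 //.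
    by apply: le_lt_trans hq; rewrite mulr_ge0 ?sqr_ge0 // ltW.
  rewrite -scalemxAr dotZl dotZr mulrA -invfM -expr2 rr [ltRHS]mulrC ltr_pdivlMr //.
move: hm; set e := c * _; set y := enorm _ => hm h1 h2; lra.
Qed.

Lemma measurable_opnorm_ge {disp} {T : measurableType disp} (A : T -> 'M[R]_d)
    (c : R) : (0 < d)%N -> 0 < c ->
  (forall i j, measurable_fun setT (fun w => A w i j)) ->
  measurable [set w | c <= opnorm (A w)].
Proof.
move=> d0 c0 mA.
pose x (q : {ffun 'I_d -> rat}) : 'cV[R]_d := \col_j ratr (q j).
have -> : [set w | c <= opnorm (A w)] =
    \bigcap_(m in [set: nat]) \bigcup_(q in [set: {ffun 'I_d -> rat}])
      [set w | (c - c * m.+1%:R^-1) ^+ 2 * dot (x q) (x q) <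
               dot (A w *m x q) (A w *m x q)].
  apply/seteqP; split=> w /=.
    by move=> /opnorm_geP-/(_ d0 c0) h m _; have [q] := h m; exists q.
  move=> h; apply/opnorm_geP => // m.
  by have [q _] := h m I; exists q.
apply: bigcapT_measurable => m; apply: countable_bigcupT_measurable => [|q].
  exact: countableP.
apply: measurable_lt_set; first exact: measurable_cst.
under eq_fun do rewrite dotE.
apply: measurable_sum => i; apply: measurable_funM;
  (under eq_fun do rewrite mxE; apply: measurable_sum => j;
   apply: measurable_funM => //; exact: measurable_cst).
Qed.

End OpnormMeasurable.

(** * Expectations of products of independent variables *)

Section Independence.
Context {disp : measure_display} {T : measurableType disp} {R : realType}.
Variable P : probability T R.
Context {disp' : measure_display} {T' : measurableType disp'}.

Import HBSimple HBNNSimple.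

Lemma integral_indic_comp (X : {RV P >-> T'}) (B : set T') : measurable B ->
  (\int[P]_w (\1_B (X w))%:E = P (X @^-1` B))%E.
Proof.
move=> mB; transitivity (\int[P]_w (\1_(X @^-1` B) w)%:E)%E.
  by apply: eq_integral => w _; rewrite !indicE; congr (_%:R)%:E.
rewrite integral_indic // ?setIT // -[_ @^-1` _]setTI.
exact: (measurable_funP X).
Qed.

(** The class of functions [g] for which [E (g(X) W) = c E g(X)] contains the
    indicators by hypothesis, hence the simple functions by linearity, hence
    every nonnegative function by monotone convergence. *)
Lemma integral_factor (X : {RV P >-> T'}) (W : T -> R) (c : R) (g : T' -> R) :
  measurable_fun setT W -> (forall w, 0 <= W w) -> 0 <= c ->
  (forall B, measurable B ->
     (\int[P]_w (\1_B (X w) * W w)%:E = c%:E * P (X @^-1` B))%E) ->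
  measurable_fun setT g -> (forall x, 0 <= g x) ->
  (\int[P]_w (g (X w) * W w)%:E = c%:E * \int[P]_w (g (X w))%:E)%E.
Proof.
move=> mW W0 c0 hB mg g0.
have mX : measurable_fun setT X by exact: measurable_funP.
have mEg : measurable_fun setT (EFin \o g) by exact/measurable_EFinP.
pose f := nnsfun_approx measurableT mEg.
have simple n : (\int[P]_w (f n (X w) * W w)%:E =
    c%:E * \int[P]_w (f n (X w))%:E)%E.
  pose s := fset_set (f n @` setT).
  have s0 (i : 'I_(#|`s|)) : 0 <= s`_i.
    have : s`_i \in s by apply: mem_nth.
    by rewrite in_fset_set // => /set_mem[x _ <-].
  have mA r : measurable (f n @^-1` [set r]) by exact: measurable_sfunP.
  have m1 r : measurable_fun setT (fun w => \1_(f n @^-1` [set r]) (X w) : R).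
    by apply: measurableT_comp => //; exact: measurable_indic.
  under eq_integral => w _ do rewrite fimfunEord mulr_suml -sumEFin.
  under [in RHS]eq_integral => w _ do rewrite fimfunEord -sumEFin.
  rewrite ge0_integral_sum //; last 2 first.
  - move=> i; apply/measurable_EFinP; apply: measurable_funM => //.
    by apply: measurable_funM.
  - by move=> i w _; rewrite lee_fin !mulr_ge0.
  rewrite ge0_integral_sum //; last 2 first.
  - by move=> i; apply/measurable_EFinP; apply: measurable_funM.
  - by move=> i w _; rewrite lee_fin !mulr_ge0.
  rewrite ge0_sume_distrr; last first.
    by move=> i _; apply: integral_ge0 => w _; rewrite lee_fin !mulr_ge0.
  apply: eq_bigr => i _.
  under eq_integral => w _ do rewrite -mulrA EFinM.
  under [in RHS]eq_integral => w _ do rewrite EFinM.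
  rewrite ge0_integralZl_EFin //; last 2 first.
  - by move=> w _; rewrite lee_fin !mulr_ge0.
  - by apply/measurable_EFinP; exact: measurable_funM.
  rewrite ge0_integralZl_EFin //; last first.
    by apply/measurable_EFinP.
  by rewrite hB // integral_indic_comp // muleCA.
have fcvg x : EFin \o f ^~ x @ \oo --> (g x)%:E.
  by apply: (@cvg_nnsfun_approx _ _ _ _ measurableT _ mEg) => // y _; rewrite lee_fin.
have fcvgR x : f ^~ x @ \oo --> g x by apply/fine_cvg: (fcvg x).
have fnd x : {homo (f ^~ x) : m n / (m <= n)%N >-> m <= n}.
  by move=> m n mn; exact/lefP/nd_nnsfun_approx.
have mf n : measurable_fun setT (fun w => f n (X w)).
  by apply: measurableT_comp => //; exact: measurable_funP.
transitivity (limn (fun n => \int[P]_w (f n (X w) * W w)%:E)%E).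
  rewrite -monotone_convergence //.
  - apply: eq_integral => w _; apply/esym/cvg_lim => //.
    apply: cvg_EFin; first exact: nearW.
    apply: cvgM; [exact: fcvgR|exact: cvg_cst].
  - by move=> n; apply/measurable_EFinP; exact: measurable_funM.
  - by move=> n w _; rewrite lee_fin mulr_ge0.
  - by move=> w _ m n mn; rewrite lee_fin ler_wpM2r // fnd.
under eq_fun do rewrite simple.
apply/cvg_lim => //; apply: cvgeZl => //.
have -> : (\int[P]_w (g (X w))%:E = \int[P]_w limn (fun n => (f n (X w))%:E))%E.
  by apply: eq_integral => w _; apply/esym/cvg_lim => //; exact: fcvg.
apply: cvg_monotone_convergence => //.
- by move=> n; exact/measurable_EFinP.
- by move=> n w _; rewrite lee_fin.
- by move=> w _ m n mn; rewrite lee_fin fnd.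
Qed.

(** Independence is a statement about events; it is transported to functions by
    replacing the indicators with the [g i] one index at a time. *)
Lemma mutually_independent_integral n (X : 'I_n -> {RV P >-> T'})
    (g : 'I_n -> T' -> R) (c : 'I_n -> R) :
  mutually_independent X ->
  (forall i, measurable_fun setT (g i)) -> (forall i x, 0 <= g i x) ->
  (forall i, (\int[P]_w (g i (X i w))%:E = (c i)%:E)%E) ->
  (\int[P]_w (\prod_i g i (X i w))%:E = (\prod_i c i)%:E)%E.
Proof.
move=> iX.
have mX i : measurable_fun setT (X i) by exact: measurable_funP.
have mXB i B : measurable B -> measurable (X i @^-1` B).
  by move=> mB; rewrite -[_ @^-1` _]setTI; exact: mX.
suff H k : (k <= n)%N -> forall (g : 'I_n -> T' -> R) (c : 'I_n -> R),
    (forall i : 'I_n, (k <= i)%N -> exists2 B, measurable B & g i = \1_B) ->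
    (forall i, measurable_fun setT (g i)) -> (forall i x, 0 <= g i x) ->
    (forall i, (\int[P]_w (g i (X i w))%:E = (c i)%:E)%E) ->
    (\int[P]_w (\prod_i g i (X i w))%:E = (\prod_i c i)%:E)%E.
  by apply: (H n) => // i; rewrite leqNgt ltn_ord.
elim: k => [_|k IH kn] {}g {}c hg mg g0 gc.
  have /choice[B hB] : forall i, exists B, measurable B /\ g i = \1_B.
    by move=> i; have [B mB gB] := hg i (leq0n _); exists B.
  have iB i : (\int[P]_w (g i (X i w))%:E = P (X i @^-1` B i))%E.
    by case: (hB i) => mB ->; exact: integral_indic_comp.
  have := iX [set: 'I_n]%SET B (fun i => (hB i).1).
  have -> : (\prod_(i in [set: 'I_n]%SET) P (X i @^-1` B i) = (\prod_i c i)%:E)%E.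
    by rewrite -prodEFin; apply: eq_big => [i|i _]; rewrite ?inE // -iB gc.
  move=> <-; set S := \bigcap_(_ in _) _.
  have mS : measurable S.
    by apply: fin_bigcap_measurable => [|i _]; [exact: finite_finset|apply: mXB; case: (hB i)].
  rewrite -[X in P X]setIT -(integral_indic _ measurableT) //.
  apply: eq_integral => w _; congr _%:E; rewrite indicE.
  have [wS|wS] := boolP (w \in S).
    rewrite big1 // => i _; rewrite (hB i).2 indicE mem_set //.
    by move: wS => /set_mem /(_ i); apply => /=; rewrite inE.
  apply/eqP; rewrite prodf_seq_eq0; apply: contraR wS => /hasPn h.
  apply: mem_set => i _ /=; have := h i (mem_index_enum _).
  by rewrite (hB i).2 indicE /=; have [/set_mem //|] := boolP (X i w \in B i); rewrite eqxx.
pose j := Ordinal kn.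
pose W w := \prod_(i | i != j) g i (X i w).
have mW : measurable_fun setT W.
  rewrite /W; under eq_fun do rewrite -big_filter.
  by apply: measurable_prod => i _; apply: measurableT_comp.
have W0 w : 0 <= W w by apply: prodr_ge0.
have c0 i : 0 <= c i.
  by rewrite -lee_fin -gc integral_ge0 // => w _; rewrite lee_fin.
transitivity (\int[P]_w (g j (X j w) * W w)%:E)%E.
  by apply: eq_integral => w _; rewrite (bigD1 j).
rewrite (@integral_factor (X j) W (\prod_(i | i != j) c i)) //.
- by rewrite gc -EFinM [in RHS](bigD1 j) //= mulrC.
- by apply: prodr_ge0.
- move=> B mB.
  pose g' i := if i == j then \1_B else g i.
  pose c' i := if i == j then fine (P (X j @^-1` B)) else c i.
  have := IH (ltnW kn) g' c'.
  have Pfin : P (X j @^-1` B) \is a fin_num by apply: fin_num_measure; exact: mXB.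
  have -> : (\prod_i c' i)%:E = ((\prod_(i | i != j) c i)%:E * P (X j @^-1` B))%E.
    rewrite (bigD1 j) //= {1}/c' eqxx EFinM fineK // muleC; congr (_%:E * _)%E.
    by apply: eq_bigr => i /negPf ij; rewrite /c' ij.
  move=> <-.
  + apply: eq_integral => w _; rewrite (bigD1 j) //= {1}/g' eqxx.
    by congr (_ * _)%:E; apply: eq_bigr => i /negPf ij; rewrite /g' ij.
  + move=> i ki; rewrite /g'; case: eqP => [_|/eqP ij]; first by exists B.
    apply: hg; rewrite ltn_neqAle ki andbT; apply: contra ij => /eqP kE.
    by apply/eqP/val_inj.
  + by move=> i; rewrite /g'; case: eqP => // _; exact: measurable_indic.
  + by move=> i x; rewrite /g'; case: eqP.
  + move=> i; rewrite /g' /c'; case: eqP => [->|//]; rewrite fineK //.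
    exact: integral_indic_comp.
Qed.

End Independence.

(** * Bernstein's inequality *)

Section ExpTail.
Context {R : realType}.
Implicit Types x : R.

Lemma cvg_expR_tail x :
  \sum_(k < n) x ^+ k.+2 / (k.+2)`!%:R @[n --> \oo] --> expR x - 1 - x.
Proof.
have : [sequence series (exp_coeff x) (n + 2)%N]_n @ \oo --> expR x.
  by rewrite cvg_shiftn; exact: is_cvg_series_exp_coeff.
have c1 : (fun _ : nat => 1 + x) @ \oo --> 1 + x by exact: cvg_cst.
have E n : \sum_(k < n) x ^+ k.+2 / (k.+2)`!%:R =
    series (exp_coeff x) (n + 2)%N - (1 + x).
  rewrite /series /= addn2 big_mkord !big_ord_recl /= /exp_coeff /=.
  under [in RHS]eq_bigr do rewrite /bump /= !add1n.
  by rewrite expr0 expr1 fact0 factS mul1n !divr1; ring.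
move=> h; under eq_fun do rewrite E.
have -> : expR x - 1 - x = expR x - (1 + x) by ring.
exact: cvgB h c1.
Qed.

(** Separating the linear term keeps the sign of [x] in it, so that a centred
    variable contributes nothing at first order. *)
Lemma expR_le_abs_tail x : expR x <= 1 + x + (expR `|x| - 1 - `|x|).
Proof.
suff : expR x - 1 - x <= expR `|x| - 1 - `|x| by lra.
apply: ler_cvg_to (cvg_expR_tail x) (cvg_expR_tail `|x|) _.
apply: nearW => n; apply: ler_sum => k _; rewrite ler_wpM2r ?invr_ge0 //.
by rewrite -normrX ler_norm.
Qed.

Lemma ler_sum_ord_ge0 (f : nat -> R) i j : (forall k, 0 <= f k) -> (i <= j)%N ->
  \sum_(k < i) f k <= \sum_(k < j) f k.
Proof.
move=> f0 ij; rewrite -!(big_mkord xpredT f) (big_cat_nat _ ij) //=.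
by rewrite lerDl sumr_ge0.
Qed.

Lemma geometric_tail_le x n : 0 <= x <= 1 / 2 ->
  \sum_(k < n) x ^+ k.+2 <= 2 * x ^+ 2.
Proof.
move=> /andP[x0 x1].
under eq_bigr do rewrite -addn2 exprD.
rewrite -mulr_suml ler_wpM2r ?sqr_ge0 //.
have := subrX1 x n; have : 0 <= x ^+ n by rewrite exprn_ge0.
set S := \sum_(i < n) _; have : 0 <= S by apply: sumr_ge0 => i _; rewrite exprn_ge0.
nra.
Qed.

End ExpTail.

Section Bernstein.
Context {disp : measure_display} {T : measurableType disp} {R : realType}.
Variable P : probability T R.

Lemma expectationE (Z : T -> R) : ('E_P[Z] = \int[P]_w (Z w)%:E)%E.
Proof. by rewrite unlock. Qed.

(** Expand the exponential: the terms of order at least 2 are dominated by the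
    geometric series of ratio [`|lam| * b <= 1 / 2], hence by twice its first
    term. *)
Lemma mgf_le (Y : T -> R) (m a b lam : R) :
  P.-integrable setT (EFin \o Y) -> 'E_P[Y]%E = m%:E -> 0 <= a -> 0 <= b ->
  (forall k, (2 <= k)%N ->
     ('E_P[fun w => (`|Y w| ^+ k)%R] <= (k`!%:R * a * b ^+ k)%:E)%E) ->
  `|lam| * b <= 1 / 2 ->
  ('E_P[fun w => expR (lam * Y w)%R] <= (expR (lam * m + 2 * a * (lam * b) ^+ 2))%:E)%E.
Proof.
rewrite !expectationE => iY Ym a0 b0 hY lb.
have mY : measurable_fun setT Y.
  by apply/measurable_EFinP; case/integrableP: iY.
pose q := `|lam| * b.
have q0 : 0 <= q by rewrite mulr_ge0.
pose H w := expR `|lam * Y w| - 1 - `|lam * Y w|.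
have mlY : measurable_fun setT (fun w => lam * Y w) by exact: measurable_funM.
have mnlY : measurable_fun setT (fun w => `|lam * Y w|).
  exact: measurableT_comp.
have mH : measurable_fun setT H.
  by apply: measurable_funB => //; apply: measurable_funB => //; exact: measurableT_comp.
have H0 w : 0 <= H w.
  by rewrite /H; have := expR_ge1Dx `|lam * Y w|; lra.
pose g n w := (\sum_(k < n) `|lam * Y w| ^+ k.+2 / (k.+2)`!%:R)%:E.
have mterm k : measurable_fun setT (fun w => `|lam * Y w| ^+ k.+2 / (k.+2)`!%:R).
  by apply: measurable_funM => //; exact: measurable_funX.
have mg n : measurable_fun setT (g n).
  apply/measurable_EFinP; exact: measurable_sum.
have term0 k w : 0 <= `|lam * Y w| ^+ k.+2 / (k.+2)`!%:R.
  by rewrite divr_ge0 // exprn_ge0.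
have gle n : (\int[P]_w g n w <= (2 * a * q ^+ 2)%:E)%E.
  under eq_integral do rewrite /g -sumEFin.
  rewrite ge0_integral_sum //; last by move=> i; exact/measurable_EFinP.
  apply: (@le_trans _ _ (\sum_(k < n) (a * q ^+ k.+2)%:E)%E); last first.
    rewrite sumEFin lee_fin -mulr_sumr -mulrA mulrCA ler_wpM2l //.
    by apply: geometric_tail_le; rewrite q0.
  apply: lee_sum => k _.
  have -> : (\int[P]_w (`|lam * Y w| ^+ k.+2 / (k.+2)`!%:R)%:E =
     \int[P]_w ((`|lam| ^+ k.+2 / (k.+2)`!%:R)%:E * (`|Y w| ^+ k.+2)%:E))%E.
    by apply: eq_integral => w _; rewrite -EFinM normrM exprMn mulrAC.
  rewrite ge0_integralZl_EFin; last first.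
  - by rewrite divr_ge0 // exprn_ge0.
  - by apply/measurable_EFinP; apply: measurable_funX; exact: measurableT_comp.
  - by move=> w _; rewrite lee_fin exprn_ge0.
  - by [].
  apply: le_trans (lee_wpmul2l _ _) _; [|rewrite -expectationE; exact: hY|].
    by rewrite lee_fin divr_ge0 // exprn_ge0.
  rewrite -EFinM lee_fin /q exprMn le_eqVlt; apply/orP; left; apply/eqP.
  by field; rewrite pnatr_eq0 -lt0n fact_gt0.
have Hle : (\int[P]_w (H w)%:E <= (2 * a * q ^+ 2)%:E)%E.
  have -> : (\int[P]_w (H w)%:E = \int[P]_w limn (g ^~ w))%E.
    apply: eq_integral => w _; apply/esym/cvg_lim => //.
    by apply: cvg_EFin; [exact: nearW|exact: cvg_expR_tail].
  rewrite monotone_convergence //.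
  - apply: lime_le; last exact: nearW.
    apply: ereal_nondecreasing_is_cvgn => i j ij; apply: ge0_le_integral => //.
    + by move=> w _; rewrite lee_fin sumr_ge0.
    + move=> w _; rewrite lee_fin.
      exact: (@ler_sum_ord_ge0 R (fun k => `|lam * Y w| ^+ k.+2 / (k.+2)`!%:R)).
  - by move=> n w _; rewrite lee_fin sumr_ge0.
  - move=> w _ i j ij; rewrite lee_fin.
    exact: (@ler_sum_ord_ge0 R (fun k => `|lam * Y w| ^+ k.+2 / (k.+2)`!%:R)).
have iH : P.-integrable setT (EFin \o H).
  apply/integrableP; split; first exact/measurable_EFinP.
  under eq_integral do rewrite /= ger0_norm //.
  by apply: le_lt_trans Hle _; rewrite ltry.
have il : P.-integrable setT (fun w => (lam%:E * (Y w)%:E)%E) by exact: integrableZl.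
have i1 : P.-integrable setT (fun w => (1 + lam%:E * (Y w)%:E)%E).
  by apply: integrableD => //; exact: (finite_measure_integrable_cst P 1).
apply: (@le_trans _ _ (\int[P]_w (1 + lam%:E * (Y w)%:E + (H w)%:E))%E).
  apply: ge0_le_integral.
  - by [].
  - by move=> w _; rewrite lee_fin expR_ge0.
  - by apply/measurable_EFinP; exact: measurableT_comp.
  - by apply: emeasurable_funD; [case/integrableP: i1|exact/measurable_EFinP].
  - move=> w _; rewrite -EFinM -!EFinD lee_fin; exact: expR_le_abs_tail.
rewrite integralD // integralD //; last exact: (finite_measure_integrable_cst P 1).
rewrite integral_cst // -[X in (1 * X)%E]/(P setT) (probability_setT P) mule1 integralZl // Ym.
apply: (@le_trans _ _ (1 + lam%:E * m%:E + (2 * a * q ^+ 2)%:E)%E).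
  by rewrite leeD2l.
rewrite -EFinM -!EFinD lee_fin; apply: le_trans (expR_ge1Dx _).
by rewrite /q exprMn real_normK ?num_real // exprMn addrA.
Qed.

Context {disp' : measure_display} {T' : measurableType disp'}.

(** Chernoff's bound with the parameter [q / b], where [q] is the minimum of
    [sqrt (r / (2 a))], which balances the two terms of the exponent, and of
    [1 / 2], the largest value for which the exponential moment is controlled. *)
Lemma bernstein n (X : 'I_n -> {RV P >-> T'}) (f : T' -> R) (m a b r : R) :
  (0 < n)%N -> mutually_independent X -> measurable_fun setT f ->
  (forall i, P.-integrable setT (fun w => (f (X i w))%:E)) ->
  (forall i, 'E_P[fun w => f (X i w)] <= m%:E)%E -> 0 < a -> 0 < b -> 0 <= r ->
  (forall i k, (2 <= k)%N ->
     ('E_P[fun w => (`|f (X i w)| ^+ k)%R] <= (k`!%:R * a * b ^+ k)%:E)%E) ->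
  (P [set w | (m + b * (2 * Num.sqrt (2 * a * r) + 4 * r)
               <= n%:R^-1 * \sum_i f (X i w))%R]
   <= (expR (- (n%:R * r)))%:E)%E.
Proof.
move=> n0 iX mf fint fm a0 b0 r0 hk.
have nR : 0 < n%:R :> R by rewrite ltr0n.
set y := 2 * Num.sqrt (2 * a * r) + 4 * r.
have [q [q0 q2 hq]] : exists q, [/\ 0 <= q, q <= 1 / 2 & r <= q * y - 2 * a * q ^+ 2].
  have s0 : 0 <= r / (2 * a) by rewrite divr_ge0 // mulr_ge0 // ltW.
  have [h|h] := leP (Num.sqrt (r / (2 * a))) (1 / 2).
    exists (Num.sqrt (r / (2 * a))); split => //; rewrite ?sqrtr_ge0 //.
    have -> : y = 4 * a * Num.sqrt (r / (2 * a)) + 4 * r.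
      rewrite /y; congr (_ + _).
      have -> : 2 * a * r = (2 * a) ^+ 2 * (r / (2 * a)) by field; rewrite gt_eqF.
      by rewrite sqrtrM ?sqr_ge0 // sqrtr_sqr ger0_norm ?mulr_ge0 ?(ltW a0) //; ring.
    have E : 2 * a * Num.sqrt (r / (2 * a)) ^+ 2 = r.
      by rewrite sqr_sqrtr //; field; rewrite gt_eqF.
    have := sqrtr_ge0 (r / (2 * a)); move: E; set q := Num.sqrt _; nra.
  exists (1 / 2); split; [lra|lra|].
  have : (1 / 2) ^+ 2 < r / (2 * a).
    by rewrite -[ltRHS]sqr_sqrtr //; move: h; set z := Num.sqrt _; nra.
  rewrite ltr_pdivlMr; last lra.
  by have := sqrtr_ge0 (2 * a * r); rewrite /y; set z := Num.sqrt _; lra.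
pose lam := q / b.
have lam0 : 0 <= lam by rewrite divr_ge0 // ltW.
have lamb : lam * b = q by rewrite divfK // gt_eqF.
pose M := expR (lam * m + 2 * a * q ^+ 2).
have mX i : measurable_fun setT (X i) by exact: measurable_funP.
have mfX i : measurable_fun setT (fun w => f (X i w)) by exact: measurableT_comp.
have hM i : ('E_P[fun w => expR (lam * f (X i w))%R] <= M%:E)%E.
  have Efin : 'E_P[fun w => f (X i w)]%E \is a fin_num.
    by rewrite expectationE; exact: integrable_fin_num.
  have h := @mgf_le (fun w => f (X i w)) (fine 'E_P[fun w => f (X i w)]%E) a b lam
    (fint i) (esym (fineK Efin)) (ltW a0) (ltW b0) (hk i).
  apply: le_trans (h _) _; first by rewrite ger0_norm // lamb.
  rewrite lee_fin ler_expR lamb lerD2r ler_wpM2l //.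
  by rewrite -lee_fin fineK.
pose g (x : T') := expR (lam * f x).
have mg : measurable_fun setT g.
  by apply: measurableT_comp => //; exact: measurable_funM.
pose c i := fine ('E_P[fun w => g (X i w)])%E.
have cE i : ('E_P[fun w => g (X i w)] = (c i)%:E)%E.
  rewrite fineK // ge0_fin_numE; first by apply: le_lt_trans (hM i) (ltry _).
  by rewrite expectationE integral_ge0 // => w _; rewrite lee_fin expR_ge0.
have cM i : 0 <= c i <= M.
  rewrite -!lee_fin -cE hM andbT expectationE integral_ge0 // => w _.
  by rewrite lee_fin expR_ge0.
have prodE : (\int[P]_w (\prod_i g (X i w))%:E = (\prod_i c i)%:E)%E.
  apply: (mutually_independent_integral P n X (fun _ => g) c) => //.
    by move=> i x; exact: expR_ge0.
  by move=> i; rewrite -expectationE.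
pose A := [set w | m + b * y <= n%:R^-1 * \sum_i f (X i w)].
have mS : measurable_fun setT (fun w => n%:R^-1 * \sum_i f (X i w)).
  by apply: measurable_funM => //; exact: measurable_sum.
have mA : measurable A.
  rewrite -[A]setTI; apply: measurable_fun_le => //.
have mprod : measurable_fun setT (fun w => \prod_i g (X i w)).
  by apply: measurable_prod => i _; exact: measurableT_comp.
pose K := expR (- (lam * (n%:R * (m + b * y)))).
have -> : P A = (\int[P]_w (\1_A w)%:E)%E by rewrite integral_indic // setIT.
apply: (@le_trans _ _ (\int[P]_w (K%:E * (\prod_i g (X i w))%:E))%E).
  apply: ge0_le_integral => //.
  - by apply/measurable_EFinP; exact: measurable_indic.
  - by apply/measurable_EFinP; exact: measurable_funM.
  - move=> w _; rewrite -EFinM lee_fin indicE.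
    have [/set_mem wA|_] := boolP (w \in A); last first.
      by rewrite mulr_ge0 ?expR_ge0 // prodr_ge0 // => i _; exact: expR_ge0.
    rewrite -expR_sum -expRD -[leLHS]expR0 ler_expR -mulr_sumr addrC subr_ge0.
    by rewrite ler_wpM2l // -ler_pdivlMl.
rewrite ge0_integralZl_EFin; last first.
- exact: expR_ge0.
- exact/measurable_EFinP.
- by move=> w _; rewrite lee_fin prodr_ge0 // => i _; exact: expR_ge0.
- by [].
rewrite prodE -EFinM lee_fin.
apply: (@le_trans _ _ (K * M ^+ n)).
  rewrite ler_wpM2l ?expR_ge0 // -[X in M ^+ X]card_ord -prodr_const.
  exact: ler_prod.
rewrite /K /M -expRM_natl -expRD ler_expR.
have -> : - (lam * (n%:R * (m + b * y))) + n%:R * (lam * m + 2 * a * q ^+ 2) =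
  - (n%:R * ((lam * b) * y - 2 * a * q ^+ 2)) by ring.
by rewrite lerN2 ler_wpM2l ?(ltW nR) // lamb.
Qed.

Lemma bernstein2 n (X : 'I_n -> {RV P >-> T'}) (f : T' -> R) (m a b r : R) :
  (0 < n)%N -> mutually_independent X -> measurable_fun setT f ->
  (forall i, P.-integrable setT (fun w => (f (X i w))%:E)) ->
  (forall i, 'E_P[fun w => f (X i w)] = m%:E)%E -> 0 < a -> 0 < b -> 0 <= r ->
  (forall i k, (2 <= k)%N ->
     ('E_P[fun w => (`|f (X i w)| ^+ k)%R] <= (k`!%:R * a * b ^+ k)%:E)%E) ->
  (P [set w | (b * (2 * Num.sqrt (2 * a * r) + 4 * r)
               <= `|n%:R^-1 * \sum_i f (X i w) - m|)%R]
   <= (2 * expR (- (n%:R * r)))%:E)%E.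
Proof.
move=> n0 iX mf fint fm a0 b0 r0 hk; set y := b * _.
have up := bernstein n X f m a b r n0 iX mf fint.
have low := bernstein n X (fun x => - f x) (- m) a b r n0 iX.
have mS (g : T' -> R) : measurable_fun setT g ->
    measurable_fun setT (fun w => n%:R^-1 * \sum_i g (X i w)).
  move=> mg; apply: measurable_funM => //; apply: measurable_sum => i.
  by apply: measurableT_comp => //; exact: measurable_funP.
have mle (g : T' -> R) c : measurable_fun setT g ->
    measurable [set w | c <= n%:R^-1 * \sum_i g (X i w)].
  by move=> mg; rewrite -[X in measurable X]setTI; apply: measurable_fun_le => //; exact: mS.
have mNf : measurable_fun setT (fun x => - f x) by exact: measurableT_comp.
have -> : [set w | y <= `|n%:R^-1 * \sum_i f (X i w) - m|] =
    [set w | m + y <= n%:R^-1 * \sum_i f (X i w)] `|`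
    [set w | - m + y <= n%:R^-1 * \sum_i - f (X i w)].
  apply/seteqP; split=> w /=; rewrite sumrN mulrN ler_normr.
    by move=> /orP[h|h]; [left|right]; lra.
  by move=> [h|h]; apply/orP; [left|right]; lra.
apply: le_trans (measureU2 _ (mle f _ mf) (mle (fun x => - f x) _ mNf)) _.
rewrite mulr_natl mulr2n EFinD; apply: leeD.
  by apply: up => // i; rewrite fm.
apply: low => //.
- move=> i; have := integrableZl measurableT (-1) (fint i).
  by under eq_fun do rewrite -EFinM mulN1r.
- move=> i; rewrite expectationE; under eq_integral do rewrite -mulN1r EFinM.
  by rewrite integralZl // -expectationE fm -EFinM mulN1r.
- by move=> i k k2; under eq_fun do rewrite normrN; exact: hk.
Qed.

End Bernstein.

(** * Moments of linear functionals *)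

Section Powers.
Context {R : realType}.

Lemma expR1_le4 : expR 1 <= 4 :> R.
Proof.
have h : expR (2^-1) <= 2 :> R.
  have := @expR_ge1Dx R (- 2^-1); rewrite expRN => h.
  rewrite -[leLHS]invrK -[leRHS]invrK lef_pV2 ?posrE ?invr_gt0 ?expR_gt0 //.
  lra.
have -> : 1 = 2^-1 + 2^-1 :> R by lra.
by rewrite expRD; have := expR_ge0 (2^-1 : R); nra.
Qed.

(** [k ^ k / k!] is one term of the series of [e ^ k]. *)
Lemma exprnn_le_fact k : k%:R ^+ k <= k`!%:R * 4 ^+ k :> R.
Proof.
case: k => [|k]; first by rewrite !expr0 mulr1.
have := @expR_ge1Dxn R k.+1%:R k (ler0n _ _).
have -> : expR k.+1%:R = expR 1 ^+ k.+1 :> R by rewrite -expRM_natl mulr1.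
have : expR 1 ^+ k.+1 <= 4 ^+ k.+1 :> R by rewrite lerXn2r ?nnegrE ?expR_ge0 // expR1_le4.
move=> h1 h2; rewrite mulrC -ler_pdivrMr ?ltr0n ?fact_gt0 //; lra.
Qed.

Lemma powR_le1D (t a b : R) : 0 <= t -> 0 <= a -> a <= b -> t `^ a <= 1 + t `^ b.
Proof.
move=> t0 a0 ab; have [t1|t1] := leP t 1.
  have := @ge0_ler_powR R a a0 t 1 t0 ler01 t1; rewrite powR1.
  by have := powR_ge0 t b; lra.
by have := ler_powR (ltW t1) ab; lra.
Qed.

Lemma powR_le_id (x p : R) : 1 <= x -> p <= 1 -> x `^ p <= x.
Proof.
by move=> x1 p1; rewrite -[leRHS]powRr1 ?ler_powR // (le_trans ler01).
Qed.

Lemma powR1D_le4 (x : R) : 0 < x -> (x + 1) `^ (x^-1) <= 4.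
Proof.
move=> x0; apply: le_trans expR1_le4.
rewrite /powR gt_eqF; last lra.
rewrite ler_expR mulrC ler_pdivrMr // mul1r addrC.
by apply: le_ln1Dx; lra.
Qed.

End Powers.

Section Moments.
Context {disp : measure_display} {T : measurableType disp} {R : realType}.
Variable P : probability T R.

Lemma expectation_mono (f g : T -> R) :
  measurable_fun setT f -> measurable_fun setT g ->
  (forall w, 0 <= f w <= g w) -> ('E_P[f] <= 'E_P[g])%E.
Proof.
move=> mf mg fg; rewrite !expectationE; apply: ge0_le_integral => //.
- by move=> w _; rewrite lee_fin; case/andP: (fg w).
- exact/measurable_EFinP.
- exact/measurable_EFinP.
- by move=> w _; rewrite lee_fin; case/andP: (fg w).
Qed.

Lemma expectation_affine (f : T -> R) (a b : R) : 0 <= a -> 0 <= b ->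
  measurable_fun setT f -> (forall w, 0 <= f w) ->
  ('E_P[fun w => (a + b * f w)%R] = a%:E + b%:E * 'E_P[f])%E.
Proof.
move=> a0 b0 mf f0; rewrite !expectationE.
under eq_integral do rewrite EFinD EFinM.
rewrite ge0_integralD //; last first.
- by apply/measurable_EFinP; exact: measurable_funM.
- by move=> w _; rewrite mule_ge0 // lee_fin.
rewrite integral_cst // -[X in (_ * X + _)%E]/(P setT) (probability_setT P) mule1.
rewrite ge0_integralZl_EFin //; first by move=> w _; rewrite lee_fin.
exact/measurable_EFinP.
Qed.

Context {d : nat}.
Variables (Y : T -> 'cV[R]_d) (alpha sigma L : R).
Hypothesis alpha2 : 2 <= alpha.
Hypothesis sigma0 : 0 < sigma.
Hypothesis sigmaL : sigma <= L.
Hypothesis mY : forall j, measurable_fun setT (fun w => Y w j 0).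
Hypothesis hY : forall u k, unit_sphere R d u -> (2 <= k)%N ->
  ('E_P[fun w => (`|dot (Y w) u| ^+ k)%R]
   <= (k%:R `^ (k%:R / alpha) * sigma ^+ 2 * L ^+ (k - 2))%:E)%E.

Lemma measurable_dot v : measurable_fun setT (fun w => dot (Y w) v).
Proof.
under eq_fun do rewrite dotE.
by apply: measurable_sum => j; apply: measurable_funM.
Qed.

Let L0 : 0 < L. Proof. exact: lt_le_trans sigma0 sigmaL. Qed.

(** By homogeneity the moment bounds pass from the sphere to the ball, where
    the points of the net lie. *)
Lemma moment_ball v k : dot v v <= 1 -> (2 <= k)%N ->
  ('E_P[fun w => (`|dot (Y w) v| ^+ k)%R]
   <= (k%:R `^ (k%:R / alpha) * sigma ^+ 2 * L ^+ (k - 2))%:E)%E.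
Proof.
move=> v1 k2; have [v0|v0] := eqVneq (dot v v) 0.
  have -> : (fun w => `|dot (Y w) v| ^+ k) = cst 0.
    apply/funext => w; rewrite (dot_eq0 _ v0) /dot mulmx0 mxE normr0 expr0n.
    by rewrite gtn_eqF // ltnW.
  by rewrite expectation_cst lee_fin !mulr_ge0 ?powR_ge0 ?exprn_ge0 // ltW.
pose r := Num.sqrt (dot v v).
have r0 : 0 < r by rewrite sqrtr_gt0 lt_neqAle eq_sym v0 dot_ge0.
have rr : r ^+ 2 = dot v v by rewrite sqr_sqrtr // dot_ge0.
have r1 : r <= 1 by rewrite -(ler_pXn2r (n := 2)) ?nnegrE ?(ltW r0) // rr expr1n.
apply: le_trans (hY (r^-1 *: v) k _ k2); last first.
  by apply/unit_sphere_dot; rewrite dotZl dotZr mulrA -invfM -expr2 rr mulVf // gt_eqF.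
apply: expectation_mono.
- by apply: measurable_funX; apply: measurableT_comp => //; exact: measurable_dot.
- by apply: measurable_funX; apply: measurableT_comp => //; exact: measurable_dot.
move=> w; rewrite exprn_ge0 //= lerXn2r ?nnegrE // dotZr normrM.
by rewrite ler_peMl // ger0_norm ?invr_ge0 ?(ltW r0) // invf_ge1.
Qed.

Let alpha_gt0 : 0 < alpha. Proof. by move: alpha2; lra. Qed.

Let sigmaL2 k : (2 <= k)%N -> sigma ^+ 2 * L ^+ (k - 2) = (sigma / L) ^+ 2 * L ^+ k.
Proof.
move=> k2; rewrite -[in RHS](subnK k2) exprD expr_div_n.
by field; rewrite gt_eqF.
Qed.

Let ratio_le1 : (sigma / L) ^+ 2 <= 1.
Proof.
by rewrite -[leRHS](expr1n _ 2) lerXn2r ?nnegrE ?divr_ge0 ?(ltW sigma0) ?(ltW L0) //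
  ler_pdivrMr // mul1r.
Qed.

(** The next three lemmas put the moments of [Z := dot Y v], of [Z ^ 2] and of
    [|Z| ^ alpha] in the form [k! a b ^ k] that Bernstein's inequality takes;
    the factor [4 ^ k] pays for replacing [k ^ k] with [k!]. *)
Lemma moment_linear v k : dot v v <= 1 -> (2 <= k)%N ->
  ('E_P[fun w => (`|dot (Y w) v| ^+ k)%R] <= (k`!%:R * 1 * (4 * L) ^+ k)%:E)%E.
Proof.
move=> v1 k2; apply: le_trans (moment_ball v k v1 k2) _.
have k1 : 1 <= k%:R :> R by rewrite ler1n; lia.
rewrite lee_fin -mulrA sigmaL2 // mulr1 [(4 * _) ^+ _]exprMn [leLHS]mulrA [leRHS]mulrA.
have h : k%:R `^ (k%:R / alpha) <= k`!%:R * 4 ^+ k.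
  apply: le_trans (exprnn_le_fact k); rewrite -powR_mulrn //.
  apply: ler_powR => //; rewrite ler_pdivrMr //.
  by move: k1 alpha2; nra.
rewrite ler_wpM2r ?exprn_ge0 ?(ltW L0) //.
rewrite -[leRHS]mulr1; by apply: ler_pM; rewrite ?powR_ge0 ?sqr_ge0.
Qed.

Lemma moment_square v k : dot v v <= 1 -> (1 <= k)%N ->
  ('E_P[fun w => (`|dot (Y w) v ^+ 2| ^+ k)%R]
   <= (k`!%:R * (sigma / L) ^+ 2 * (8 * L ^+ 2) ^+ k)%:E)%E.
Proof.
move=> v1 k1.
under eq_fun do rewrite normrX -exprM.
have k2 : (2 <= 2 * k)%N by lia.
apply: le_trans (moment_ball v (2 * k) v1 k2) _.
rewrite lee_fin -mulrA sigmaL2 // [(8 * _) ^+ _]exprMn -[(L ^+ 2) ^+ _]exprM [leLHS]mulrA [leRHS]mulrA.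
rewrite ler_wpM2r ?exprn_ge0 ?(ltW L0) // mulrAC ler_wpM2r ?sqr_ge0 //.
have -> : 8 ^+ k = 4 ^+ k * 2 ^+ k :> R by rewrite -exprMn; congr (_ ^+ _); lra.
rewrite mulrA; apply: le_trans (ler_wpM2r _ (exprnn_le_fact k)); last by rewrite exprn_ge0.
rewrite -exprMn -natrM [(k * 2)%N]mulnC -powR_mulrn //.
apply: ler_powR; first by rewrite ler1n; lia.
by rewrite ler_pdivrMr // natrM mulrC ler_wpM2l.
Qed.

(** The exponent [alpha * k] need not be an integer; since [t ^ a <= 1 + t ^ p]
    for [a <= p], a rescaled moment of integer order [p] close to [alpha * k]
    controls it at the cost of a factor 2. *)
Lemma moment_alpha v k : dot v v <= 1 -> (1 <= k)%N ->
  ('E_P[fun w => (`| `|dot (Y w) v| `^ alpha| ^+ k)%R]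
   <= (k`!%:R * 2 * (4 * (alpha + 1) * L `^ alpha) ^+ k)%:E)%E.
Proof.
move=> v1 k1.
have kR : 1 <= k%:R :> R by rewrite ler1n.
pose p := (Num.truncn (alpha * k%:R)).+1.
have ak0 : 0 <= alpha * k%:R by rewrite mulr_ge0 // ltW.
have /andP[p1 p2] := truncn_itv ak0.
rewrite -/p in p2.
have p3 : p%:R <= alpha * k%:R + 1 by rewrite /p -natr1 lerD2r.
have pR : 2 <= p%:R :> R.
  by apply: ltW; apply: le_lt_trans p2; move: kR alpha2; nra.
have pN : (2 <= p)%N by rewrite -(ler_nat R).
have pgt0 : 0 < p%:R :> R by lra.
(* s is the natural scale of the moment of order p. *)
pose s := L * p%:R `^ (alpha^-1).
have s0 : 0 < s by rewrite mulr_gt0 // powR_gt0.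
pose c := (L `^ alpha * p%:R) ^+ k.
have c0 : 0 <= c by rewrite exprn_ge0 // mulr_ge0 ?powR_ge0.
have pw z : 0 <= z -> (z `^ alpha) ^+ k <= c + c / s ^+ p * z ^+ p.
  move=> z0.
  have sE : s `^ alpha = L `^ alpha * p%:R.
    by rewrite powRM ?powR_ge0 ?(ltW L0) // -powRrM mulVf ?gt_eqF // powRr1 // ltW.
  have -> : (z `^ alpha) ^+ k = c * (z / s) `^ (alpha * k%:R).
    rewrite /c -sE -!powR_mulrn ?powR_ge0 // -!powRrM -powRM ?divr_ge0 ?(ltW s0) //.
    by rewrite [s * _]mulrC divfK // gt_eqF.
  have h := powR_le1D (z / s) _ p%:R (divr_ge0 z0 (ltW s0)) ak0 (ltW p2).
  apply: le_trans (ler_wpM2l c0 h) _.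
  by rewrite powR_mulrn ?divr_ge0 ?(ltW s0) // expr_div_n mulrDr mulr1 [z ^+ p / _]mulrC mulrA.
have mz : measurable_fun setT (fun w => `|dot (Y w) v|).
  by apply: measurableT_comp => //; exact: measurable_dot.
apply: (@le_trans _ _ ('E_P[fun w => (c + c / s ^+ p * `|dot (Y w) v| ^+ p)%R])%E).
  apply: expectation_mono.
  - apply: measurable_funX; apply: measurableT_comp => //.
    exact: (@measurableT_comp _ _ _ _ _ _ (@powR R ^~ alpha)).
  - by apply: measurable_funD => //; apply: measurable_funM => //; exact: measurable_funX.
  - by move=> w; rewrite exprn_ge0 //= ger0_norm ?powR_ge0 // pw.
have cs0 : 0 <= c / s ^+ p by rewrite divr_ge0 // exprn_ge0 // ltW.
rewrite expectation_affine //; last exact: measurable_funX.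
apply: (@le_trans _ _ (c + c)%:E).
  rewrite EFinD leeD2l //.
  apply: le_trans (lee_wpmul2l _ (moment_ball v p v1 pN)) _; first by rewrite lee_fin.
  rewrite -EFinM lee_fin -[p%:R `^ _ * _ * _]mulrA sigmaL2 //.
  have -> : p%:R `^ (p%:R / alpha) = (p%:R `^ alpha^-1) ^+ p.
    by rewrite -powR_mulrn ?powR_ge0 // -powRrM mulrC.
  rewrite [X in _ * X]mulrCA -exprMn [_ * L]mulrC -/s mulrCA divfK ?gt_eqF ?exprn_gt0 //.
  by rewrite ler_piMl.
rewrite lee_fin -mulr2n -mulr_natl /c !exprMn.
have h : p%:R ^+ k <= (k`!%:R * 4 ^+ k) * (alpha + 1) ^+ k.
  apply: le_trans (ler_wpM2r _ (exprnn_le_fact k)); last first.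
    by rewrite exprn_ge0 //; move: alpha2; lra.
  by rewrite -exprMn lerXn2r ?nnegrE ?mulr_ge0 //; move: alpha2; nra.
have LA : 0 <= (L `^ alpha) ^+ k by rewrite exprn_ge0 // powR_ge0.
nra.
Qed.

End Moments.

(** * The sample covariance and its expectation *)

Section SampleCovariance.
Context {R : realType} {d n : nat}.

Lemma sample_cov_sym (x : 'I_n -> 'cV[R]_d) : (sample_cov x)^T = sample_cov x.
Proof.
rewrite /sample_cov linearZ /= linear_sum /=; congr (_ *: _).
by apply: eq_bigr => i _; rewrite trmx_mul trmxK.
Qed.

Lemma sample_cov_quad_form (x : 'I_n -> 'cV[R]_d) (mu v : 'cV[R]_d) : (0 < n)%N ->
  dot v (sample_cov x *m v) =
  n%:R^-1 * \sum_i dot (x i - mu) v ^+ 2 - (n%:R^-1 * \sum_i dot (x i - mu) v) ^+ 2.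
Proof.
move=> n0; have nR : n%:R != 0 :> R by rewrite pnatr_eq0 -lt0n.
pose z i := dot (x i - mu) v.
have E i : dot (x i - sample_mean x) v = z i - n%:R^-1 * \sum_j z j.
  rewrite /z /sample_mean dotDl dotNl dotZl dot_suml dotDl dotNl.
  under [in RHS]eq_bigr do rewrite dotDl dotNl.
  by rewrite big_split /= sumr_const card_ord -mulr_natl; field.
have -> : dot v (sample_cov x *m v) = n%:R^-1 * \sum_i dot (x i - sample_mean x) v ^+ 2.
  rewrite /sample_cov -scalemxAl dotZr; congr (_ * _).
  rewrite mulmx_suml dotC dot_suml; apply: eq_bigr => i _.
  rewrite dotC /dot -!mulmxA mulmxA mxE big_ord1 expr2; congr (_ * _).
  by rewrite -/(dot v _) dotC.
under eq_bigr do rewrite E.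
set m := n%:R^-1 * \sum_j z j.
have -> : \sum_i (z i - m) ^+ 2 = \sum_i z i ^+ 2 - 2 * m * \sum_i z i + n%:R * m ^+ 2.
  rewrite mulr_sumr -sumrB -[n%:R * _](_ : \sum_(i < n) m ^+ 2 = _); last first.
    by rewrite sumr_const card_ord mulr_natl.
  by rewrite -big_split /=; apply: eq_bigr => i _; ring.
have -> : \sum_i z i = n%:R * m by rewrite /m mulVKf.
by field.
Qed.

End SampleCovariance.

Section FirstMoments.
Context {disp : measure_display} {T : measurableType disp} {R : realType}.
Variable P : probability T R.

Lemma expectation_linear (I : finType) (a c : I -> R) (h : I -> T -> R) :
  (forall i, P.-integrable setT (fun w => (h i w)%:E)) ->
  (forall i, 'E_P[h i] = (c i)%:E)%E ->
  P.-integrable setT (fun w => (\sum_i a i * h i w)%:E) /\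
  ('E_P[fun w => (\sum_i a i * h i w)%R] = (\sum_i a i * c i)%:E)%E.
Proof.
move=> ih hc.
have ia i : P.-integrable setT (fun w => ((a i)%:E * (h i w)%:E)%E).
  exact: integrableZl.
have E w : (\sum_i a i * h i w)%:E = (\sum_i (a i)%:E * (h i w)%:E)%E.
  by rewrite -sumEFin; apply: eq_bigr => i _; rewrite EFinM.
split; first by under eq_fun do rewrite E; exact: integrable_sum.
rewrite expectationE; under eq_integral do rewrite E.
rewrite integral_sum // -sumEFin; apply: eq_bigr => i _.
by rewrite integralZl // -expectationE hc EFinM.
Qed.

Context {d : nat}.
Variables (Y : T -> 'cV[R]_d) (mu : 'cV[R]_d).

Lemma expectation_dot_centered v : has_expectation P Y mu ->
  P.-integrable setT (fun w => (dot (Y w - mu) v)%:E) /\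
  ('E_P[fun w => dot (Y w - mu) v] = 0)%E.
Proof.
move=> hY.
pose h (j : 'I_d) w := Y w j 0 - mu j 0.
have ih j : P.-integrable setT (fun w => (h j w)%:E).
  have [iY _] := hY j 0.
  have := integrableB measurableT iY (finite_measure_integrable_cst P (mu j 0) measurableT).
  by [].
have [||i1 i2] := expectation_linear 'I_d (fun j => v j 0) (fun=> 0) h.
- exact: ih.
- move=> j; have [iY EY] := hY j 0.
  rewrite expectationE; under eq_integral do rewrite EFinB.
  rewrite integralB_EFin //; last exact: finite_measure_integrable_cst.
  rewrite -expectationE EY integral_cst // -[X in (_ - _ * X)%E]/(P setT).
  by rewrite (probability_setT P) mule1 -EFinB subrr.
have E w : dot (Y w - mu) v = \sum_j v j 0 * h j w.
  by rewrite dotC dotE; apply: eq_bigr => j _; rewrite !mxE.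
split; first by under eq_fun do rewrite E.
under eq_fun do rewrite E.
by rewrite i2 big1 // => j _; rewrite mulr0.
Qed.

Lemma expectation_dot_sqr Sigma v : has_covariance P Y mu Sigma ->
  P.-integrable setT (fun w => (dot (Y w - mu) v ^+ 2)%:E) /\
  ('E_P[fun w => (dot (Y w - mu) v ^+ 2)%R] = (dot v (Sigma *m v))%:E)%E.
Proof.
move=> hY.
have [||i1 i2] := expectation_linear ('I_d * 'I_d)%type (fun p => v p.1 0 * v p.2 0)
  (fun p => Sigma p.1 p.2) (fun p w => ((Y w - mu) *m (Y w - mu)^T) p.1 p.2).
- by move=> p; have [] := hY p.1 p.2.
- by move=> p; have [] := hY p.1 p.2.
have E w : dot (Y w - mu) v ^+ 2 =
    \sum_p v p.1 0 * v p.2 0 * ((Y w - mu) *m (Y w - mu)^T) p.1 p.2.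
  rewrite expr2 dotC dotE big_distrlr /=.
  rewrite (pair_bigA _ (fun i j => v i 0 * (Y w - mu) i 0 * (v j 0 * (Y w - mu) j 0))) /=.
  by apply: eq_bigr => p _; rewrite [(_ *m _) _ _]mxE big_ord1 !mxE; ring.
split; first by under eq_fun do rewrite E.
under eq_fun do rewrite E.
rewrite i2 dotE -(pair_bigA _ (fun i j => v i 0 * v j 0 * Sigma i j)) /=.
congr _%:E; apply: eq_bigr => i _; rewrite mxE mulr_sumr.
by apply: eq_bigr => j _; ring.
Qed.

Lemma covariance_sym Sigma : has_covariance P Y mu Sigma -> Sigma^T = Sigma.
Proof.
move=> hY; apply/matrixP => i j; rewrite mxE; apply/EFin_inj.
have [_ <-] := hY i j; have [_ <-] := hY j i.
by congr expectation; apply/funext => w; rewrite !mxE !big_ord1 !mxE mulrC.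
Qed.

End FirstMoments.

(** * Tail bounds for the operator norm *)

Section NetTail.
Context {disp : measure_display} {T : measurableType disp} {R : realType}.
Variable P : probability T R.

Lemma union_bound (I : finType) (N : {set I}) (E : I -> set T) (p : R) :
  (forall i, measurable (E i)) -> (forall i, i \in N -> (P (E i) <= p%:E)%E) ->
  (P (\big[setU/set0]_(i in N) E i) <= (#|N|%:R * p)%:E)%E.
Proof.
move=> mE hE.
have -> : #|N|%:R * p = \sum_(i in N) p by rewrite sumr_const mulr_natl.
rewrite -sumEFin.
suff [] : measurable (\big[setU/set0]_(i in N) E i) /\
    (P (\big[setU/set0]_(i in N) E i) <= \sum_(i in N) p%:E)%E by [].
elim/big_rec2: _ => [|i s B iN [mB hB]]; first by rewrite measure0; split.
split; first exact: measurableU.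
by apply: le_trans (measureU2 _ (mE i) mB) _; apply: leeD => //; exact: hE.
Qed.

(** The net has at most [64 ^ d] points and [4 * 64 ^ d <= e ^ (8 d)], so the
    exponent [8 (t + d)] pays for the union over the net. *)
Lemma opnorm_tail_from_net d (A : T -> 'M[R]_d) (E : 'cV[R]_d -> set T) (B c t : R) :
  (0 < d)%N -> 0 < B -> 2 * B < c -> 0 < t ->
  (forall w, (A w)^T = A w) ->
  (forall i j, measurable_fun setT (fun w => A w i j)) ->
  (forall v, measurable (E v)) ->
  (forall v, dot v v <= 1 -> (P (E v) <= (4 * expR (- (8 * (t + d%:R))))%:E)%E) ->
  (forall w v, dot v v <= 1 -> ~ E v w -> `|dot v (A w *m v)| <= B) ->
  (P [set w | (c <= opnorm (A w))%R] <= (2 * expR (- t))%:E)%E.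
Proof.
move=> d0 B0 Bc t0 sA mA mE hE hB.
pose N := [set f in net d | dot (lattice_pt d f) (lattice_pt d f) <= 1 :> R]%SET.
pose U := \big[setU/set0]_(f in N) E (lattice_pt d f).
have mU : measurable U by apply: bigsetU_measurable => f _; exact: mE.
have sub : [set w | c <= opnorm (A w)] `<=` U.
  move=> w /= cA; apply: contrapT => nU.
  have : opnorm (A w) <= 2 * B.
    apply: opnorm_le => //; first by rewrite mulr_gt0.
    pose V := [set v | exists2 f, f \in N & v = lattice_pt d f] : set 'cV[R]_d.
    apply: (quad_form_net _ B V) => //.
      move=> x /(net_covers d x d0)[f fN [f1 f2]].
      exists (lattice_pt d f) => //; exists f => //.
      by rewrite inE fN f1.
    move=> _ [f fN ->]; apply: hB => [|Ef].
      by move: fN; rewrite inE => /andP[].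
    apply: nU.
    by rewrite /U (bigD1 f) //=; left.
  by move: cA; lra.
apply: (@le_trans _ _ (P U)).
  apply: le_measure => //; apply: mem_set => //.
  by apply: measurable_opnorm_ge => //; lra.
apply: le_trans (union_bound _ N _ _ (fun f => mE _) _) _.
  by move=> f; rewrite inE => /andP[_ f1]; exact: hE.
rewrite lee_fin.
have hN : #|N|%:R <= 64 ^+ d :> R.
  apply: le_trans (card_net d); rewrite ler_nat subset_leq_card //.
  by apply/fintype.subsetP => f; rewrite inE => /andP[].
apply: (@le_trans _ _ (64 ^+ d * (4 * expR (- (8 * (t + d%:R)))))).
  by rewrite ler_wpM2r // mulr_ge0 // expR_ge0.
have -> : - (8 * (t + d%:R)) = - t + (- (7 * t) + d%:R * - 8) by ring.
rewrite !expRD expRM_natl.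
set e8 := expR (- 8); set et := expR (- t).
have e8le : e8 <= 256^-1.
  have -> : e8 = expR (-1) ^+ 8 by rewrite -expRM_natl; congr expR; lra.
  have -> : 256^-1 = 2^-1 ^+ 8 :> R by rewrite exprVn; congr (_^-1); lra.
  rewrite lerXn2r ?nnegrE ?expR_ge0 // expRN lef_pV2 ?posrE ?expR_gt0 //.
  by have := @expR_ge1Dx R 1; lra.
have t7 : expR (- (7 * t)) <= 1 by rewrite expR_le1; lra.
have : 64 ^+ d * e8 ^+ d <= 4^-1.
  rewrite -exprMn; apply: (@le_trans _ _ (4^-1 ^+ d)).
    by rewrite lerXn2r ?nnegrE ?mulr_ge0 ?expR_ge0 //; lra.
  case: d d0 {E mA mE hE hB sA A N U mU sub hN} => // d _.
  by rewrite exprS ler_piMr // exprn_ile1 //; lra.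
have : 0 <= 64 ^+ d * e8 ^+ d by rewrite mulr_ge0 ?exprn_ge0 ?expR_ge0.
have := expR_ge0 (- t); rewrite -/et.
have := expR_ge0 (- (7 * t)); move: t7; set x := expR (- (7 * t)).
have -> : 64 ^+ d * (4 * (et * (x * e8 ^+ d))) = 4 * et * (x * (64 ^+ d * e8 ^+ d)) by ring.
set z := 64 ^+ d * e8 ^+ d => x1 x0 et0 z0 z4.
have : x * z <= 4^-1 by nra.
have : 0 <= x * z by rewrite mulr_ge0.
by nra.
Qed.

End NetTail.

Section MainEstimates.
Context {R : realType} {disp : measure_display} {T : measurableType disp}.
Variables (P : probability T R) (d n : nat) (X : 'I_n -> {RV P >-> d.-tuple R}).
Variables (mu : 'cV[R]_d) (Sigma : 'M[R]_d) (alpha sigma L t delta : R).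
Hypothesis alpha2 : 2 <= alpha.
Hypothesis sigma0 : 0 < sigma.
Hypothesis sigmaL : sigma <= L.
Hypothesis d0 : (0 < d)%N.
Hypothesis n0 : (0 < n)%N.
Hypothesis indX : mutually_independent X.
Hypothesis meanX : forall i, has_expectation P (fun w => tcol (X i w)) mu.
Hypothesis covX : forall i, has_covariance P (fun w => tcol (X i w)) mu Sigma.
Hypothesis momX : forall (i : 'I_n) u k, unit_sphere R d u -> (2 <= k)%N ->
  ('E_P[fun w => (`|dot (tcol (X i w) - mu) u| ^+ k)%R]
   <= (k%:R `^ (k%:R / alpha) * sigma ^+ 2 * L ^+ (k - 2))%:E)%E.
Hypothesis t0 : 0 < t.
Hypothesis deltaE : n%:R * delta = t + d%:R.

Let Z (v : 'cV[R]_d) (x : d.-tuple R) := dot (tcol x - mu) v.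
Let A w := sample_cov (fun i => tcol (X i w)) - Sigma.

Let L0 : 0 < L. Proof. exact: lt_le_trans sigma0 sigmaL. Qed.
Let nR : 0 < n%:R :> R. Proof. by rewrite ltr0n. Qed.

Let delta0 : 0 < delta.
Proof. by rewrite -(pmulr_rgt0 _ nR) deltaE ltr_wpDr. Qed.

Let i0 := Ordinal n0.

Let mcol j : measurable_fun setT (fun x : d.-tuple R => (tcol x - mu) j 0).
Proof.
under eq_fun do rewrite !mxE.
by apply: measurable_funB => //; exact: measurable_tnth.
Qed.

Let mZ v : measurable_fun setT (Z v).
Proof.
rewrite /Z; under eq_fun do rewrite dotE.
by apply: measurable_sum => j; apply: measurable_funM.
Qed.

Let mX i : measurable_fun setT (X i).
Proof. exact: measurable_funP. Qed.

Let mXcol i j : measurable_fun setT (fun w => (tcol (X i w) - mu) j 0).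
Proof. exact: (measurableT_comp (mcol j) (mX i)). Qed.

Let sym_A w : (A w)^T = A w.
Proof.
by rewrite /A linearB /= sample_cov_sym (covariance_sym P _ _ _ (covX i0)).
Qed.

Let measurable_A i j : measurable_fun setT (fun w => A w i j).
Proof.
pose xb k w := n%:R^-1 * \sum_(l < n) tnth (X l w) k.
have mt l k : measurable_fun setT (fun w => tnth (X l w) k).
  exact: (measurableT_comp (measurable_tnth k) (mX l)).
have mxb k : measurable_fun setT (xb k).
  by apply: measurable_funM => //; exact: measurable_sum.
have E w : A w i j = n%:R^-1 * \sum_(l < n)
    (tnth (X l w) i - xb i w) * (tnth (X l w) j - xb j w) - Sigma i j.
  rewrite /A /sample_cov !mxE summxE; congr (_ * _ - _).
  apply: eq_bigr => l _; rewrite mxE big_ord1 !mxE !summxE.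
  by congr ((_ - _ * _) * (_ - _ * _)); apply: eq_bigr => k _; rewrite mxE.
under eq_fun do rewrite E.
apply: measurable_funB => //; apply: measurable_funM => //.
apply: measurable_sum => l; apply: measurable_funM; exact: measurable_funB.
Qed.

Let quad_A w v : dot v (A w *m v) = n%:R^-1 * \sum_i Z v (X i w) ^+ 2
  - (n%:R^-1 * \sum_i Z v (X i w)) ^+ 2 - dot v (Sigma *m v).
Proof. by rewrite mulmxBl dotDr dotNr (sample_cov_quad_form _ mu). Qed.

Let measurable_ge (f : T -> R) c : measurable_fun setT f -> measurable [set w | c <= f w].
Proof.
by move=> mf; rewrite -[X in measurable X]setTI; apply: measurable_fun_le.
Qed.

Let mavg (f : d.-tuple R -> R) : measurable_fun setT f ->
  measurable_fun setT (fun w => n%:R^-1 * \sum_i f (X i w)).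
Proof.
move=> mf; apply: measurable_funM => //; apply: measurable_sum => i.
exact: (measurableT_comp mf (mX i)).
Qed.

Let variance_bounds v : dot v v <= 1 -> 0 <= dot v (Sigma *m v) <= 2 * L ^+ 2.
Proof.
move=> v1; have [_ E] := expectation_dot_sqr P _ _ _ v (covX i0).
rewrite -!lee_fin -E; apply/andP; split.
  by rewrite expectationE integral_ge0 // => w _; rewrite lee_fin sqr_ge0.
have h := moment_ball P _ alpha sigma L sigma0 sigmaL (mXcol i0) (momX i0) v 2 v1 isT.
under eq_fun do rewrite -real_normK ?num_real //.
apply: le_trans h _; rewrite lee_fin subnn expr0 mulr1.
apply: ler_pM; rewrite ?powR_ge0 ?sqr_ge0 //.
  by apply: powR_le_id; [lra|rewrite ler_pdivrMr; move: alpha2; lra].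
by rewrite lerXn2r ?nnegrE // ltW.
Qed.

Let r_eq : n%:R * (8 * delta) = 8 * (t + d%:R).
Proof. by rewrite mulrCA deltaE. Qed.

(** Bernstein's inequality for [Z ^ 2], whose deviation has the two scales
    [sigma L] and [L ^ 2], and for [Z], whose squared mean is of order
    [L ^ 2 delta] as long as [delta <= 1]. *)
Lemma tail_small_delta c : delta <= 1 ->
  4 * 160 ^+ 2 * (sigma * L * Num.sqrt delta + L ^+ 2 * delta) < c ->
  (P [set w | (c <= opnorm (A w))%R] <= (2 * expR (- t))%:E)%E.
Proof.
move=> d1 hc.
set sd := Num.sqrt delta in hc *.
have sd0 : 0 < sd by rewrite sqrtr_gt0.
have sdd : sd ^+ 2 = delta by rewrite sqr_sqrtr // ltW.
have U0 : 0 < sigma * L * sd + L ^+ 2 * delta.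
  by apply: addr_gt0; apply: mulr_gt0 => //; [exact: mulr_gt0|exact: exprn_gt0].
pose s2 v := dot v (Sigma *m v).
pose y1 := 8 * L ^+ 2 * (2 * Num.sqrt (2 * (sigma / L) ^+ 2 * (8 * delta)) + 4 * (8 * delta)).
pose y2 := 4 * L * (2 * Num.sqrt (2 * 1 * (8 * delta)) + 4 * (8 * delta)).
pose E1 v := [set w | y1 <= `|n%:R^-1 * \sum_i Z v (X i w) ^+ 2 - s2 v|].
pose E2 v := [set w | y2 <= `|n%:R^-1 * \sum_i Z v (X i w) - 0|].
have mE1 v : measurable (E1 v).
  apply: measurable_ge; apply: measurableT_comp => //; apply: measurable_funB => //.
  by apply: (mavg (fun x => Z v x ^+ 2)); exact: measurable_funX.
have mE2 v : measurable (E2 v).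
  by apply: measurable_ge; apply: measurableT_comp => //; apply: measurable_funB => //;
     exact: mavg.
have y1E : y1 = 64 * (sigma * L * sd) + 256 * (L ^+ 2 * delta).
  rewrite /y1; have -> : 2 * (sigma / L) ^+ 2 * (8 * delta) = (4 * (sigma / L) * sd) ^+ 2.
    by rewrite !exprMn sdd; ring.
  rewrite sqrtr_sqr ger0_norm; first by field; rewrite gt_eqF.
  by rewrite !mulr_ge0 ?invr_ge0 // ltW.
have y2le : 0 <= y2 <= 160 * (L * sd).
  have E : Num.sqrt (2 * 1 * (8 * delta)) = 4 * sd.
    have -> : 2 * 1 * (8 * delta) = (4 * sd) ^+ 2 by rewrite exprMn sdd; ring.
    by rewrite sqrtr_sqr ger0_norm // mulr_ge0 // ltW.
  rewrite /y2 E; have sd1 : sd <= 1 by rewrite -sqrtr1 ler_wsqrtr.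
  rewrite mulr_ge0 ?addr_ge0 ?mulr_ge0 ?(ltW sd0) ?(ltW L0) ?(ltW delta0) //=.
  have -> : 160 * (L * sd) = 4 * L * (40 * sd) by ring.
  rewrite ler_wpM2l ?mulr_ge0 ?(ltW L0) //.
  by move: sdd sd0 sd1; nra.
apply: (opnorm_tail_from_net P d A (fun v => E1 v `|` E2 v)
  (2 * 160 ^+ 2 * (sigma * L * sd + L ^+ 2 * delta)) c t) => //.
- by rewrite mulr_gt0.
- by apply: le_lt_trans hc; lra.
- by move=> v; exact: measurableU.
- move=> v v1; apply: le_trans (measureU2 _ (mE1 v) (mE2 v)) _.
  have -> : 4 * expR (- (8 * (t + d%:R))) =
    2 * expR (- (n%:R * (8 * delta))) + 2 * expR (- (n%:R * (8 * delta))).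
    by rewrite r_eq; ring.
  rewrite EFinD; apply: leeD.
    apply: (bernstein2 P n X (fun x => Z v x ^+ 2)) => //.
    + exact: measurable_funX.
    + by move=> i; have [] := expectation_dot_sqr P _ _ _ v (covX i).
    + by move=> i; have [] := expectation_dot_sqr P _ _ _ v (covX i).
    + by rewrite exprn_gt0 // divr_gt0.
    + by rewrite !mulr_gt0.
    + by rewrite mulr_ge0 // ltW.
    + move=> i k k2; apply: (moment_square P _ alpha sigma L alpha2 sigma0 sigmaL
        (mXcol i) (momX i)) => //.
      exact: ltnW.
  apply: (bernstein2 P n X (Z v)) => //.
  + by move=> i; have [] := expectation_dot_centered P _ _ v (meanX i).
  + by move=> i; have [] := expectation_dot_centered P _ _ v (meanX i).
  + by rewrite mulr_gt0.
  + by rewrite mulr_ge0 // ltW.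
  + move=> i k k2; exact: (moment_linear P _ alpha sigma L alpha2 sigma0 sigmaL
        (mXcol i) (momX i)).
- move=> w v v1 /not_orP[/negP h1 /negP h2].
  move: h1 h2; rewrite -!ltNge subr0 => h1 h2.
  rewrite quad_A addrAC -/(s2 v).
  set m2 := n%:R^-1 * _ in h1 *; set m1 := n%:R^-1 * _ in h2 *.
  apply: le_trans (ler_normB _ _) _.
  have m1le : `|m1 ^+ 2| <= 160 ^+ 2 * (L ^+ 2 * delta).
    have -> : 160 ^+ 2 * (L ^+ 2 * delta) = (160 * (L * sd)) ^+ 2.
      by rewrite !exprMn sdd; ring.
    case/andP: y2le => y20 y2l.
    rewrite normrX lerXn2r ?nnegrE //; first exact: le_trans y20 y2l.
    exact: le_trans (ltW h2) y2l.
  have : 0 <= sigma * L * sd by rewrite !mulr_ge0 // ltW.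
  have : 0 <= L ^+ 2 * delta by rewrite mulr_ge0 ?sqr_ge0 // ltW.
  by move: h1 m1le; rewrite y1E; lra.
Qed.

(** For [delta >= 1] the sum of the [Z ^ 2] is compared with that of the
    [|Z| ^ alpha], which has exponential tails: from [y <= 1 + y ^ (alpha / 2)]
    applied to [y := Z ^ 2 / M ^ (2 / alpha)], a mean of the [|Z| ^ alpha] below
    [M] forces a mean of the [Z ^ 2] below [2 M ^ (2 / alpha)]. *)
Lemma tail_large_delta c : 1 <= delta ->
  4 * 160 ^+ 2 * (L ^+ 2 * delta `^ (2 / alpha)) < c ->
  (P [set w | (c <= opnorm (A w))%R] <= (2 * expR (- t))%:E)%E.
Proof.
move=> d1 hc.
have a0 : 0 < alpha by move: alpha2; lra.
pose W v x := `|Z v x| `^ alpha.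
have mW v : measurable_fun setT (W v).
  apply: (@measurableT_comp _ _ _ _ _ _ (@powR R ^~ alpha)) => //.
  exact: measurableT_comp.
have W0 v x : 0 <= W v x by exact: powR_ge0.
pose b := 4 * (alpha + 1) * L `^ alpha.
have b0 : 0 < b by rewrite !mulr_gt0 ?powR_gt0 //; move: alpha2; lra.
pose M := 2 * b + b * (2 * Num.sqrt (2 * 2 * (8 * delta)) + 4 * (8 * delta)).
pose E v := [set w | M <= n%:R^-1 * \sum_i W v (X i w)].
have mE v : measurable (E v) by apply: measurable_ge; exact: mavg.
have M0 : 0 < M.
  have := sqrtr_ge0 (2 * 2 * (8 * delta)); move: delta0; rewrite /M.
  set q := Num.sqrt _ => dl0 q0.
  by apply: ltr_pwDl; [rewrite mulr_gt0|apply: mulr_ge0; [exact: ltW|lra]].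
have MD : M `^ (2 / alpha) <= 184 * 16 * (L ^+ 2 * delta `^ (2 / alpha)).
  have p0 : 0 <= 2 / alpha by rewrite divr_ge0 // ltW.
  have p1 : 2 / alpha <= 1 by rewrite ler_pdivrMr // mul1r.
  have a1 : 0 <= alpha + 1 by lra.
  have Mle : M <= 184 * (alpha + 1) * L `^ alpha * delta.
    have sq : Num.sqrt (2 * 2 * (8 * delta)) <= 6 * delta.
      rewrite -(ler_pXn2r (n := 2)) ?nnegrE ?sqrtr_ge0 ?mulr_ge0 ?(ltW delta0) //.
      rewrite sqr_sqrtr; first by move: d1; nra.
      by rewrite !mulr_ge0 // ltW.
    have -> : 184 * (alpha + 1) * L `^ alpha * delta = b * (46 * delta).
      by rewrite /b; ring.
    by rewrite /M [2 * b]mulrC -mulrDr ler_wpM2l ?(ltW b0) //; lra.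
  apply: le_trans (ge0_ler_powR p0 _ _ Mle) _; rewrite ?nnegrE ?(ltW M0) //.
    by rewrite !mulr_ge0 ?powR_ge0 // ltW.
  rewrite !powRM ?mulr_ge0 ?powR_ge0 ?(ltW delta0) //.
  have -> : (L `^ alpha) `^ (2 / alpha) = L ^+ 2.
    by rewrite -powRrM mulrC divfK ?gt_eqF // powR_mulrn // ltW.
  rewrite -[leLHS]mulrA; apply: ler_wpM2r.
    by rewrite mulr_ge0 ?sqr_ge0 ?powR_ge0.
  apply: ler_pM; rewrite ?powR_ge0 //; first by apply: powR_le_id => //; lra.
  rewrite mulrC powRrM powR_mulrn ?powR_ge0 //.
  have := powR1D_le4 alpha a0; have := powR_ge0 (alpha + 1) alpha^-1.
  by set z := _ `^ alpha^-1; nra.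
have dp : 1 <= delta `^ (2 / alpha).
  by rewrite -[leLHS](powRr0 delta) ler_powR // divr_ge0 // ltW.
have L2 : 0 < L ^+ 2 by rewrite exprn_gt0.
apply: (opnorm_tail_from_net P d A E
  (2 * 160 ^+ 2 * (L ^+ 2 * delta `^ (2 / alpha))) c t) => //.
- by rewrite !mulr_gt0 // powR_gt0.
- by apply: le_lt_trans hc; lra.
- move=> v v1.
  have EW i k : (1 <= k)%N ->
      ('E_P[fun w => (`|W v (X i w)| ^+ k)%R] <= (k`!%:R * 2 * b ^+ k)%:E)%E.
    exact: (moment_alpha P _ alpha sigma L alpha2 sigma0 sigmaL (mXcol i) (momX i)).
  have EW1 i : ('E_P[fun w => W v (X i w)] <= (2 * b)%:E)%E.
    have := EW i 1%N isT; rewrite factS fact0 muln1 mul1r expr1.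
    by under eq_fun do rewrite expr1 ger0_norm //.
  have mWX i : measurable_fun setT (fun w => W v (X i w)).
    exact: (measurableT_comp (mW v) (mX i)).
  apply: (@le_trans _ _ (expR (- (n%:R * (8 * delta))))%:E).
    apply: (bernstein P n X (W v)) => //.
    + move=> i; apply/integrableP; split; first exact/measurable_EFinP.
      apply: le_lt_trans (ltry (2 * b)); apply: le_trans (EW1 i).
      by rewrite expectationE; under eq_integral do rewrite /= ger0_norm //.
    + by rewrite mulr_ge0 // ltW.
    + by move=> i k k2; apply: EW; exact: ltnW.
  rewrite r_eq lee_fin; have := expR_ge0 (- (8 * (t + d%:R))); lra.
- move=> w v v1 /negP; rewrite -ltNge => hw.
  rewrite quad_A; set m1 := n%:R^-1 * \sum_i Z v (X i w).
  have m2 : 0 <= n%:R^-1 * \sum_i Z v (X i w) ^+ 2 - m1 ^+ 2.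
    rewrite -(sample_cov_quad_form (fun i => tcol (X i w)) mu v n0).
    rewrite /sample_cov -scalemxAl dotZr mulr_ge0 ?invr_ge0 // mulmx_suml.
    rewrite dotC dot_suml sumr_ge0 // => i _; rewrite dotC.
    by rewrite /dot -!mulmxA mulmxA mxE big_ord1 -/(dot v _) -/(dot _ v) dotC -expr2 sqr_ge0.
  have S2 : n%:R^-1 * \sum_i Z v (X i w) ^+ 2 <= 2 * M `^ (2 / alpha).
    pose K := M `^ (2 / alpha).
    have K0 : 0 < K by exact: powR_gt0.
    have le1 x : Z v x ^+ 2 <= K + K / M * W v x.
      pose y := `|Z v x| / M `^ (alpha^-1).
      have Ma : 0 < M `^ (alpha^-1) by exact: powR_gt0.
      have y0 : 0 <= y by rewrite divr_ge0 // ltW.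
      have := powR_le1D y 2 alpha y0 (ler0n _ 2) alpha2.
      have -> : y `^ alpha = W v x / M.
        rewrite /y /W powRM ?invr_ge0 ?(ltW Ma) // -powR_inv1 ?(ltW Ma) //.
        by rewrite -powRrM -powRrM mulN1r mulrN mulVf ?gt_eqF // powR_inv1 // ltW.
      rewrite powR_mulrn // /y expr_div_n real_normK ?num_real //.
      have -> : M `^ alpha^-1 ^+ 2 = K by rewrite /K -powR_mulrn ?powR_ge0 // -powRrM mulrC.
      rewrite ler_pdivrMr // => h; apply: le_trans h _.
      by rewrite mulrDl mul1r mulrC mulrA mulrAC.
    rewrite ler_pdivrMl //.
    apply: (@le_trans _ _ (\sum_i (K + K / M * W v (X i w)))).
      by apply: ler_sum => i _; exact: le1.
    rewrite big_split /= sumr_const card_ord -mulr_sumr -[K *+ n]mulr_natl.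
    move: hw; rewrite ltr_pdivrMl // => /ltW hw.
    have -> : n%:R * (2 * M `^ (2 / alpha)) = n%:R * K + K / M * (n%:R * M).
      by rewrite -/K; field; rewrite gt_eqF.
    by rewrite lerD2l ler_wpM2l // divr_ge0 // ltW.
  have := variance_bounds v v1; set s2 := dot v (Sigma *m v) => hs.
  rewrite ler_norml.
  have := sqr_ge0 m1; case/andP: hs => s0 s1.
  have KL : 2 * M `^ (2 / alpha) <= 2 * (184 * 16 * (L ^+ 2 * delta `^ (2 / alpha))) by lra.
  have : L ^+ 2 <= L ^+ 2 * delta `^ (2 / alpha) by rewrite ler_peMr // ltW.
  have : 0 < L ^+ 2 * delta `^ (2 / alpha) by rewrite mulr_gt0 // powR_gt0.
  move: m2 S2 KL s1; set Q := L ^+ 2 * _; set S := n%:R^-1 * _.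
  move=> m2 S2 KL s1 Q0 L2Q m10; apply/andP; split; lra.
Qed.

End MainEstimates.

(** * The concentration inequality *)

Theorem theorem8 (R : realType) :
  exists C : R, 0 < C /\
  forall (alpha sigma L : R) (d n : nat)
    (disp : measure_display) (T : measurableType disp) (P : probability T R)
    (X : 'I_n -> {RV P >-> d.-tuple R}) (mu : 'cV[R]_d) (Sigma : 'M[R]_d),
  2 <= alpha -> 0 < sigma -> sigma <= L -> (0 < d)%N -> (0 < n)%N ->
  iid X ->
  (forall i, has_expectation P (fun w => tcol (X i w)) mu) ->
  (forall i, has_covariance P (fun w => tcol (X i w)) mu Sigma) ->
  (forall (i : 'I_n) (u : 'cV[R]_d) (k : nat),
     unit_sphere R d u -> (2 <= k)%N ->
     ('E_P[fun w => (`|((tcol (X i w) - mu)^T *m u) 0 0| ^+ k)%R]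
      <= (k%:R `^ (k%:R / alpha) * sigma ^+ 2 * L ^+ (k - 2))%:E)%E) ->
  forall t : R, 0 < t ->
  (4 <= alpha ->
   (P [set w |
       (C * Num.min (L ^+ 2 * ((t + d%:R) / n%:R) `^ (2 / alpha))
                    (sigma * L * ((t + d%:R) / n%:R) `^ (1 / 2)
                     + L ^+ 2 * ((t + d%:R) / n%:R))
        <= opnorm (sample_cov (fun i => tcol (X i w)) - Sigma))%R]
    <= (2 * expR (- t))%:E)%E) /\
  (alpha <= 4 ->
   (P [set w |
       (C * sigma * L * ((t + d%:R) / n%:R) `^ (1 / 2)
        + C * Num.min (L ^+ 2 * ((t + d%:R) / n%:R) `^ (2 / alpha))
                      (L ^+ 2 * ((t + d%:R) / n%:R))
        <= opnorm (sample_cov (fun i => tcol (X i w)) - Sigma))%R]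
    <= (2 * expR (- t))%:E)%E).
Proof.
exists (10 * 160 ^+ 2); split; first by rewrite mulr_gt0 // exprn_gt0.
move=> alpha sigma L d n disp T P X mu Sigma alpha2 sigma0 sigmaL d0 n0 [indX _].
move=> meanX covX momX t t0; set C := 10 * 160 ^+ 2.
have CE : C = 10 * 160 ^+ 2 by [].
set delta := (t + d%:R) / n%:R.
have nR : 0 < n%:R :> R by rewrite ltr0n.
have deltaE : n%:R * delta = t + d%:R by rewrite mulrCA mulfV ?mulr1 // gt_eqF.
have delta0 : 0 < delta by rewrite -(pmulr_rgt0 _ nR) deltaE ltr_wpDr.
have L0 : 0 < L by exact: lt_le_trans sigmaL.
have a0 : 0 < alpha by lra.
have p0 : 0 <= 2 / alpha by rewrite divr_ge0 // ltW.
have p1 : 2 / alpha <= 1 by rewrite ler_pdivrMr // mul1r.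
clearbody delta C.
have L2 : 0 < L ^+ 2 by rewrite exprn_gt0.
have -> : delta `^ (1 / 2) = Num.sqrt delta by rewrite div1r powR12_sqrt // ltW.
set sd := Num.sqrt delta.
have sd0 : 0 < sd by rewrite sqrtr_gt0.
have sdd : sd ^+ 2 = delta by rewrite sqr_sqrtr // ltW.
set dp := delta `^ (2 / alpha).
have dp0 : 0 < dp by exact: powR_gt0.
have SL : sigma * L <= L ^+ 2 by rewrite expr2 ler_wpM2r // ltW.
have sL0 : 0 < sigma * L by rewrite mulr_gt0.
have small c : delta <= 1 -> 4 * 160 ^+ 2 * (sigma * L * sd + L ^+ 2 * delta) < c ->
    (P [set w | (c <= opnorm (sample_cov (fun i => tcol (X i w)) - Sigma))%R]
     <= (2 * expR (- t))%:E)%E.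
  exact: (tail_small_delta P d n X mu Sigma alpha sigma L t delta).
have large c : 1 <= delta -> 4 * 160 ^+ 2 * (L ^+ 2 * dp) < c ->
    (P [set w | (c <= opnorm (sample_cov (fun i => tcol (X i w)) - Sigma))%R]
     <= (2 * expR (- t))%:E)%E.
  exact: (tail_large_delta P d n X mu Sigma alpha sigma L t delta).
have U0 : 0 < sigma * L * sd + L ^+ 2 * delta by rewrite addr_gt0 // mulr_gt0.
have V0 : 0 < L ^+ 2 * dp by rewrite mulr_gt0.
(* The sign of delta - 1 decides which terms dominate: the Bernstein terms below
   1, the power 2 / alpha above, whatever the position of alpha about 4. *)
have [d1|d1] := leP delta 1.
  have sd1 : sd <= 1 by rewrite -sqrtr1 ler_wsqrtr.
  have dsd : delta <= sd by rewrite -sdd expr2 ler_piMr // ltW.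
  split=> [alpha4|_]; apply: small => //.
    have dpsd : sd <= dp.
      rewrite /sd /dp -powR12_sqrt ?(ltW delta0) //.
      by apply: ger_powR; [rewrite delta0 d1|rewrite ler_pdivrMr //; lra].
    suff : (sigma * L * sd + L ^+ 2 * delta) / 2 <=
        Num.min (L ^+ 2 * dp) (sigma * L * sd + L ^+ 2 * delta) by rewrite CE; lra.
    rewrite le_min; apply/andP; split; last lra.
    by nra.
  have ddp : delta <= dp.
    rewrite -[leLHS]powRr1 ?(ltW delta0) //; apply: ger_powR => //.
    by rewrite delta0 d1.
  have -> : Num.min (L ^+ 2 * dp) (L ^+ 2 * delta) = L ^+ 2 * delta.
    by apply: min_r; rewrite ler_wpM2l // ltW.
  by rewrite CE; lra.
have dpd : dp <= delta by rewrite -[leRHS]powRr1 ?(ltW delta0) // ler_powR // ltW.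
have LL : L ^+ 2 * dp <= L ^+ 2 * delta by rewrite ler_wpM2l // ltW.
have s0 : 0 < sigma * L * sd by rewrite mulr_gt0.
split=> [_|_]; apply: large; rewrite ?(ltW d1) // min_l ?CE //; lra.
Qed.
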